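(* Let $\mathcal{G}$ be a proper minor-closed family of graphs (for instance, planar graphs). There is a constant $c_{\mathcal{G}}$ depending only on $\mathcal{G}$ such that: (i) for every connected graph $G=(V,E)\in\mathcal{G}$ and every cost function $c:V\to\mathbb{R}_{\ge0}$, the minimum cost of a connected dominating set of $G$ is at most $c_{\mathcal{G}}$ times the optimal value of the LP $\mathrm{CDS\text{-}LP}(G,c)$; and (ii) there is a polynomial-time algorithm that, given such $G$, $c$ and any feasible solution $x$ of $\mathrm{CDS\text{-}LP}(G,c)$, outputs a connected dominating set $D$ of $G$ with $\sum_{v\in D}c(v)\le c_{\mathcal{G}}\sum_{v\in V}c(v)x(v)$.
   Context: For a vertex $v$, $\Gamma(v)$ is the set of neighbors of $v$ and $\Gamma^+(v)=\Gamma(v)\cup\{v\}$. For $S\subseteq V$, $\Gamma(S)$ is the set of vertices not in $S$ having a neighbor in $S$. Let $\mathcal{S}$ be the collection of all $S\subseteq V$ such that $S$, $\Gamma(S)$ and $V-(S\cup\Gamma(S))$ are all nonempty. A set $D$ is a dominating set if every vertex outside $D$ has a neighbor in $D$, and a connected dominating set if moreover $G[D]$ is connected. The LP $\mathrm{CDS\text{-}LP}(G,c)$ is: minimize $\sum_{v\in V}c(v)x(v)$ subject to $\sum_{u\in\Gamma^+(v)}x(u)\ge1$ for all $v\in V$, $\sum_{v\in\Gamma(S)}x(v)\ge1$ for all $S\in\mathcal{S}$, and $x(v)\ge0$ for all $v\in V$. A family of graphs is minor-closed if it is closed under taking minors; it is proper if it does not contain all graphs. *)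

(* Defs.v *)
From mathcomp Require Import all_boot all_order all_algebra.
From mathcomp Require Import classical_sets reals.
Import Order.TTheory GRing.Theory Num.Theory.

Set Implicit Arguments.
Unset Strict Implicit.
Unset Printing Implicit Defensive.

Local Open Scope ring_scope.

(** * Finite simple graphs and minors *)

Record sgraph := SGraph {
  svertex :> finType;
  sedge : rel svertex;
  sedge_sym : symmetric sedge;
  sedge_irr : irreflexive sedge }.

Section Graphs.
Variable G : sgraph.
Implicit Types (v : G) (S D : {set G}).

Definition induced S : rel G := [rel u v | [&& u \in S, v \in S & sedge u v]].

(* The induced subgraph on S is connected; the null graph is not connected. *)
Definition connected_set S : Prop :=
  S != finset.set0 /\ {in S &, forall u v, connect (induced S) u v}.

Definition connected_graph : Prop := connected_set [set: G]%SET.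

Definition nbr v : {set G} := [set u | sedge v u]%SET.
Definition cnbr v : {set G} := (v |: nbr v)%SET.

Definition nbr_set S : {set G} :=
  [set v | (v \notin S) && [exists u in S, sedge u v]]%SET.

(* The collection of sets S indexing the connectivity constraints of the LP. *)
Definition separating S : bool :=
  [&& S != finset.set0, nbr_set S != finset.set0
    & ~: (S :|: nbr_set S) != finset.set0]%SET.

Definition dominating D : Prop :=
  forall v, v \notin D -> exists2 u, u \in D & sedge v u.

Definition cds D : Prop := dominating D /\ connected_set D.

End Graphs.

(* H is a minor of G, by branch sets: pairwise disjoint nonempty connected
   vertex sets of G, one per vertex of H, joined by an edge of G whenever the
   corresponding vertices are adjacent in H.  This is invariant under
   isomorphism of H and of G. *)
Definition minor (H G : sgraph) : Prop :=
  exists B : H -> {set G},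
    [/\ forall a, connected_set (B a),
        forall a b, a != b -> [disjoint B a & B b]
      & forall a b, sedge a b ->
          exists u v, [/\ u \in B a, v \in B b & sedge u v]].

Definition minor_closed (F : sgraph -> Prop) : Prop :=
  forall G H, F G -> minor H G -> F H.

Definition proper_family (F : sgraph -> Prop) : Prop := exists G, ~ F G.

(** * The linear program *)

Definition cost (R : numDomainType) (G : sgraph) (c : G -> R) (D : {set G}) : R :=
  \sum_(v in D) c v.

Definition lp_cost (R : numDomainType) (G : sgraph) (c x : G -> R) : R :=
  \sum_v c v * x v.

Definition lp_feasible (R : numDomainType) (G : sgraph) (x : G -> R) : Prop :=
  [/\ forall v, 1 <= \sum_(u in cnbr v) x u,
      forall S : {set G}, separating S -> 1 <= \sum_(v in nbr_set S) x v
    & forall v, 0 <= x v].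

Definition lp_opt (R : realType) (G : sgraph) (c : G -> R) : R :=
  inf [set lp_cost c x | x in [set x : G -> R | lp_feasible x]]%classic.

Definition min_cds (R : numDomainType) (G : sgraph) (c : G -> R)
    (D : {set G}) : Prop :=
  cds D /\ forall D' : {set G}, cds D' -> cost c D <= cost c D'.

(** * Random access machines under the logarithmic cost criterion

   Structured programs over a random access memory of natural numbers, which
   is split into banks: [EGet a e] reads the cell of bank [a] at the (computed)
   address [e], and [CPut a e1 e2] writes [e2] there.  A program mentions only
   finitely many banks, so they interleave into a single memory with a
   constant factor.  Every value that is computed, read, written or used as an
   address is charged its binary length, as in Aho, Hopcroft and Ullman, "The
   Design and Analysis of Computer Algorithms", section 1.3; running times are
   therefore polynomially related to those of Turing machines. *)

Local Open Scope nat_scope.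

Inductive expr : Type :=
| EConst of nat
| EGet of nat & expr
| EAdd of expr & expr
| ESub of expr & expr
| EMul of expr & expr
| EDiv of expr & expr.

Inductive cmd : Type :=
| CSkip
| CPut of nat & expr & expr
| CSeq of cmd & cmd
| CIf of expr & cmd & cmd
| CWhile of expr & cmd.

Definition state : Type := nat -> nat -> nat.

Definition update (s : state) (a i k : nat) : state :=
  fun a' i' => if (a' == a) && (i' == i) then k else s a' i'.

(* [trunc_log 2 0 = 0], so that [0] has length [1]. *)
Definition bitlen (n : nat) : nat := (trunc_log 2 n).+1.

Fixpoint eval (s : state) (e : expr) : nat :=
  match e with
  | EConst n => n
  | EGet a e => s a (eval s e)
  | EAdd e1 e2 => eval s e1 + eval s e2
  | ESub e1 e2 => eval s e1 - eval s e2
  | EMul e1 e2 => eval s e1 * eval s e2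
  | EDiv e1 e2 => eval s e1 %/ eval s e2
  end.

Fixpoint etime (s : state) (e : expr) : nat :=
  bitlen (eval s e) +
  match e with
  | EConst _ => 0
  | EGet _ e => etime s e
  | EAdd e1 e2 | ESub e1 e2 | EMul e1 e2 | EDiv e1 e2 => etime s e1 + etime s e2
  end.

(* [exec p s t s']: started in state s, p halts in state s' after time t. *)
Inductive exec : cmd -> state -> nat -> state -> Prop :=
| exec_Skip s : exec CSkip s 1 s
| exec_Put s a e1 e2 :
    exec (CPut a e1 e2) s (etime s e1 + etime s e2)
      (update s a (eval s e1) (eval s e2))
| exec_Seq p1 p2 s s1 s2 t1 t2 :
    exec p1 s t1 s1 -> exec p2 s1 t2 s2 -> exec (CSeq p1 p2) s (t1 + t2) s2
| exec_IfT e p1 p2 s s' t :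
    eval s e != 0 -> exec p1 s t s' -> exec (CIf e p1 p2) s (etime s e + t) s'
| exec_IfF e p1 p2 s s' t :
    eval s e = 0 -> exec p2 s t s' -> exec (CIf e p1 p2) s (etime s e + t) s'
| exec_WhileT e p s s1 s2 t1 t2 :
    eval s e != 0 -> exec p s t1 s1 -> exec (CWhile e p) s1 t2 s2 ->
    exec (CWhile e p) s (etime s e + t1 + t2) s2
| exec_WhileF e p s :
    eval s e = 0 -> exec (CWhile e p) s (etime s e) s.

Lemma exec_det p s t1 s1 t2 s2 :
  exec p s t1 s1 -> exec p s t2 s2 -> t1 = t2 /\ s1 = s2.
Proof.
move=> H; elim: H t2 s2 => {p s t1 s1}.
- by move=> s t2 s2 H; inversion H.
- by move=> s a e1 e2 t2 s2 H; inversion H.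
- move=> p1 p2 s s1 s2 t1 t2 _ IH1 _ IH2 t s' H.
  inversion H as [| |? ? ? ? ? ? ? E1 E2| | | |]; subst.
  by have [? ?] := IH1 _ _ E1; subst; have [? ?] := IH2 _ _ E2; subst.
- move=> e p1 p2 s s' t Ht _ IH t2 s2 H.
  inversion H as [| | |? ? ? ? ? ? _ E|? ? ? ? ? ? H0 _| |]; subst.
    by have [? ?] := IH _ _ E; subst.
  by rewrite H0 in Ht.
- move=> e p1 p2 s s' t Ht _ IH t2 s2 H.
  inversion H as [| | |? ? ? ? ? ? H1 _|? ? ? ? ? ? _ E| |]; subst.
    by rewrite Ht in H1.
  by have [? ?] := IH _ _ E; subst.
- move=> e p s s1 s2 t1 t2 Ht _ IH1 _ IH2 t s' H.
  inversion H as [| | | | |? ? ? ? ? ? ? _ E1 E2|? ? ? H0]; subst.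
    by have [? ?] := IH1 _ _ E1; subst; have [? ?] := IH2 _ _ E2; subst.
  by rewrite H0 in Ht.
- move=> e p s Ht t2 s2 H.
  inversion H as [| | | | |? ? ? ? ? ? ? H1 _ _|]; subst => //.
  by rewrite Ht in H1.
Qed.

(* The input word fills the first cells of bank 0; all other cells are 0. *)
Definition init_state (w : seq nat) : state :=
  fun a i => if a == 0 then nth 0 w i else 0.

Definition input_size (w : seq nat) : nat := \sum_(k <- w) bitlen k.

(* On the inputs w = [enc i] of the instances i satisfying [valid], the program
   p halts within time q(|w|) in a final state that satisfies [post i]. *)
Definition polytime_solves (I : Type) (enc : I -> seq nat) (valid : I -> Prop)
    (post : I -> state -> Prop) (p : cmd) : Prop :=
  exists q : {poly nat}, forall i, valid i ->
    exists t s, [/\ exec p (init_state (enc i)) t s,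
                    t <= q.[input_size (enc i)]%R & post i s].

(** * Encoding of the instances (G, c, x) with rational c, x *)

Record instance := Instance {
  inst_graph :> sgraph;
  inst_c : inst_graph -> rat;
  inst_x : inst_graph -> rat }.

Arguments inst_c : clear implicits.
Arguments inst_x : clear implicits.

(* The number of vertices, the adjacency matrix, and the numerators and
   denominators (in lowest terms) of c and x, which are nonnegative in all
   the instances of interest. *)
Definition encode (i : instance) : seq nat :=
  let vs := enum i in
  #|i| :: [seq nat_of_bool (sedge u v) | u <- vs, v <- vs]
    ++ [seq `|numq (inst_c i v)|%N | v <- vs]
    ++ [seq `|denq (inst_c i v)|%N | v <- vs]
    ++ [seq `|numq (inst_x i v)|%N | v <- vs]
    ++ [seq `|denq (inst_x i v)|%N | v <- vs].

(* The output is the characteristic vector stored in bank 1. *)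
Definition output_set (G : sgraph) (s : state) : {set G} :=
  [set v | s 1 (enum_rank v) != 0]%SET.

(* Main.v *)
(** A dominating set is rounded from the LP first: take every vertex of large
    LP value and, for each vertex that is still undominated, its cheapest closed
    neighbour.  Graphs without a [K_h] minor are degenerate, so their edges can be
    oriented with bounded out-degree; an undominated vertex receives half of its
    coverage along incoming edges, and charging it to the tails costs [O(LP)].

    The dominating set is then connected by a local-ratio scheme.  While the set
    [X] of bought vertices is disconnected, every component of [G[X]] pays the same
    price towards each vertex of its boundary, and a vertex that is fully paid for
    is bought.  When an edge inside [X] joins two components its two ends are kept,
    so at a stage with [L] components at most [2 (L - 1)] vertices remain to be
    kept.  These vertices and the components form a minor with at most [3 L]
    vertices, hence [O(L)] edges (Mader), while every component is the index of an
    LP constraint, so that the LP pays at least [L] times the price.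

    Clearing denominators and multiplying the residual costs by the degree of the
    bought vertex keep all numbers integral and of polynomial length. *)

Require Import Defs.
From mathcomp Require Import boolp classical_sets reals.
From mathcomp Require Import all_boot all_order all_algebra.
From mathcomp Require Import zify lra.
Import Order.TTheory GRing.Theory Num.Theory.

Set Implicit Arguments.
Unset Strict Implicit.
Unset Printing Implicit Defensive.

(** * Clique minors of dense graphs *)

(** Part (i) allows real costs and so cannot be read off the program of part (ii). The invariants of
    the rounding are therefore proved over any real field and used twice: along an abstract run for
    the real numbers, and along the program for the rationals.

    Bought vertices that are not kept must not be charged, yet which ones are kept depends on later
    merges. Hence the price invariant bounds all candidate sets [T] at once, under a size budget
    that never grows.

    With [d = 2 ^ h.+1], the heavy vertices cost at most [2 * (d + 1)] times the LP, the cheapest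
    neighbours [2 * d] and the connection [3 * d], which makes [7 * d + 2].

    Under logarithmic cost, time depends on the size of every number. All loops have [n] rounds, so
    the work is a static polynomial in [n], times [b], as long as all cells stay below [2 ^ b]; the
    size [b] is bounded separately. *)

Section Density.
Variable T : finType.
Implicit Types (e : rel T) (U S : {set T}) (u v : T).

(** Connectivity and clique minors are stated for a relation on a fixed finite type, since
    contraction changes the edges but keeps the type. For [sedge] the first two notions are
    convertible to [induced] and [connected_set]. *)
Definition restr_rel e S : rel T := [rel u v | [&& u \in S, v \in S & e u v]].

Definition connected_in e S : Prop :=
  S != set0 /\ {in S &, forall u v, connect (restr_rel e S) u v}.

Definition clique_minor h e U : Prop :=
  exists B : 'I_h -> {set T},
    [/\ forall i, B i \subset U,
        forall i, connected_in e (B i),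
        forall i j, i != j -> [disjoint B i & B j]
      & forall i j, i != j ->
          exists u v, [/\ u \in B i, v \in B j & e u v]].

Lemma restr_rel_sub e S S' u v :
  S \subset S' -> connect (restr_rel e S) u v -> connect (restr_rel e S') u v.
Proof.
move=> /subsetP sSS'; apply: connect_sub => a b /and3P[/sSS' Sa /sSS' Sb eab].
by apply: connect1; apply/and3P.
Qed.

Lemma connected_in1 e u : connected_in e [set u].
Proof.
by split=> [|a b]; rewrite ?set10 // -?card_gt0 ?cards1 // => /set1P -> /set1P ->.
Qed.

Lemma connected_in2 e u v : symmetric e -> e u v -> connected_in e [set u; v].
Proof.
move=> sym_e euv; split; first by rewrite -card_gt0 cards2.
by move=> a b /set2P[]-> /set2P[]->; rewrite ?connect0 //;
   apply: connect1; apply/and3P; split; rewrite ?inE ?eqxx ?orbT // sym_e.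
Qed.

(** Minors compose: replacing each vertex [a] of a branch set by [beta a] gives a branch set again.
    This serves both contraction and the minor formed by components. *)
Lemma clique_minor_lift h e U e' U' (beta : T -> {set T}) :
  (forall a, a \in U' -> beta a \subset U) ->
  (forall a, a \in U' -> connected_in e (beta a)) ->
  {in U' &, forall a b, a != b -> [disjoint beta a & beta b]} ->
  {in U' &, forall a b, e' a b ->
     exists u v, [/\ u \in beta a, v \in beta b & e u v]} ->
  clique_minor h e' U' -> clique_minor h e U.
Proof.
move=> sub_b conn_b disj_b adj_b [B [sB cB dB aB]].
have sBi i a : a \in B i -> a \in U' by move/(subsetP (sB i)).
exists (fun i => \bigcup_(a in B i) beta a); split=> [i|i|i j ij|i j /aB].
- by apply/bigcupsP => a /sBi; apply: sub_b.
- have [/set0Pn[a0 Ba0] cBi] := cB i; split.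
    have [/set0Pn[z bz] _] := conn_b _ (sBi _ _ Ba0).
    by apply/set0Pn; exists z; apply/bigcupP; exists a0.
  set W := \bigcup_(a in B i) beta a.
  have inside a u v : a \in B i -> u \in beta a -> v \in beta a ->
      connect (restr_rel e W) u v.
    move=> Ba ua va; have [_ /(_ u v ua va)] := conn_b _ (sBi _ _ Ba).
    by apply: restr_rel_sub; apply: bigcup_sup.
  (* A walk in [B i] is lifted vertex by vertex: cross [beta a] to the end of a joining edge, step
     over the edge, continue from its other end. *)
  have across a b u v : connect (restr_rel e' (B i)) a b -> a \in B i ->
      u \in beta a -> v \in beta b -> b \in B i -> connect (restr_rel e W) u v.
    case/connectP=> p; elim: p a u => [|c p IH] a u /=.
      by move=> _ -> Ba ua va _; apply: inside va.
    case/andP=> /and3P[Ba Bc eac] pth b_eq _ ua va Bb.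
    have [y [z [ya zc eyz]]] := adj_b _ _ (sBi _ _ Ba) (sBi _ _ Bc) eac.
    apply: connect_trans (inside _ _ _ Ba ua ya) _.
    apply: (@connect_trans _ _ z); last exact: (IH c z pth).
    apply: connect1; apply/and3P; split=> //; apply/bigcupP; first by exists a.
    by exists c.
  move=> u v /bigcupP[a Ba ua] /bigcupP[b Bb vb].
  by apply: across (cBi a b Ba Bb) Ba ua vb Bb.
- rewrite -setI_eq0; apply/eqP/setP => z; rewrite !inE; apply/negP.
  case/andP=> /bigcupP[a Ba za] /bigcupP[b Bb zb].
  have ab: a != b.
    apply: contraTneq (dB _ _ ij) => ab; rewrite -setI_eq0.
    by apply/set0Pn; exists a; rewrite inE Ba ab.
  have := disj_b _ _ (sBi _ _ Ba) (sBi _ _ Bb) ab.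
  by rewrite -setI_eq0 => /eqP/setP/(_ z); rewrite !inE za zb.
- case=> a [b [Ba Bb eab]].
  have [u [v [ua vb euv]]] := adj_b _ _ (sBi _ _ Ba) (sBi _ _ Bb) eab.
  by exists u, v; split=> //; apply/bigcupP; [exists a | exists b].
Qed.

Definition nbr_in e U u : {set T} := [set v in U | e u v].
(** For symmetric [e] without loops this is twice the number of edges, so density here means average
    degree. *)
Definition arcs e U : nat := \sum_(u in U) #|nbr_in e U u|.

(** [v] is absorbed into [u]; the vertex [v] stays in the type and is dropped by passing to
    [U :\ v]. The conjunct [a != b] excludes loops. *)
Definition contract e u v : rel T :=
  [rel a b | (a != b) && [|| e a b, (a == u) && e v b | (b == u) && e a v]].

Lemma contract_sym e u v : symmetric e -> symmetric (contract e u v).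
Proof.
move=> sym_e a b; rewrite /contract /= eq_sym [e b a]sym_e [e b v]sym_e [e v a]sym_e.
by congr andb; rewrite [X in _ || X]orbC.
Qed.

(** Contraction loses the edge [uv] and, for each common neighbour, one of two parallel edges; every
    loss counts for two arcs. *)
Lemma arcs_contract e U u v : symmetric e -> irreflexive e ->
  u \in U -> v \in U -> e u v ->
  arcs e U <= arcs (contract e u v) (U :\ v)
              + (#|nbr_in e U u :&: nbr_in e U v|.+1).*2.
Proof.
move=> sym_e irr_e Uu Uv euv.
have neuv : u != v by apply: contraTneq euv => ->; rewrite irr_e.
have neuv' : v != u by rewrite eq_sym.
set N := nbr_in e U; set e' := contract e u v; set U' := U :\ v.
have e'E a b : e' a b = (a != b) && [|| e a b, (a == u) && e v b | (b == u) && e a v].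
  by [].
have U'u : u \in U' by rewrite !inE neuv.
rewrite /arcs (big_setD1 v) //= -/U' (big_setD1 u) //= [in X in _ <= X](big_setD1 u) //=.
have deg_uv : #|N v| + #|N u| <= #|nbr_in e' U' u| + (#|N u :&: N v| + 2).
  suff: #|N u :|: N v| <= #|nbr_in e' U' u| + 2 by have := cardsUI (N u) (N v); lia.
  apply: (@leq_trans #|nbr_in e' U' u :|: [set u; v]|); last first.
    by rewrite cardsU cards2 neuv; apply: leq_subr.
  apply: subset_leq_card; apply/subsetP => z; rewrite !inE e'E.
  case: (z =P u) => [|/eqP zu]; first by rewrite orbT.
  case: (z =P v) => [|/eqP zv]; first by rewrite orbT.
  by rewrite eqxx [u == z]eq_sym zu /= orbF -andb_orr => /andP[-> /orP[]->]; rewrite ?orbT.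
(* The row of another vertex shrinks only if it sees both ends, and then by at most one. *)
have deg_o : \sum_(a in U' :\ u) #|nbr_in e U a| <=
    \sum_(a in U' :\ u) #|nbr_in e' U' a| + #|N u :&: N v|.
  have -> : #|N u :&: N v| = \sum_(a in U' :\ u) (e a u && e a v).
    rewrite -sum1_card big_mkcond [RHS]big_mkcond /=; apply: eq_bigr => a _.
    rewrite !inE; case: (a =P u) => [->|_]; first by rewrite irr_e andbF.
    case: (a =P v) => [->|_]; first by rewrite irr_e !andbF.
    rewrite [e a u]sym_e [e a v]sym_e /=.
    by case: (a \in U) => //=; case: (e u a); case: (e v a).
  rewrite -big_split /=; apply: leq_sum => a; rewrite !inE => /and3P[au av Ua].
  rewrite (cardsD1 v) inE Uv /=.
  have sN : N a :\ v \subset nbr_in e' U' a.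
    apply/subsetP => z; rewrite !inE e'E => /and3P[-> -> eaz]; rewrite eaz /= andbT.
    by apply: contraTneq eaz => ->; rewrite irr_e.
  case: (boolP (e a v)) => eav; last first.
    by rewrite add0n (leq_trans (subset_leq_card sN)) ?leq_addr.
  case: (boolP (e a u)) => eau /=; first by rewrite addnC leq_add2r subset_leq_card.
  rewrite addn0 add1n; apply: proper_card; rewrite properE sN /=.
  apply/subsetPn; exists u; last by rewrite !inE (negPf eau) !andbF.
  by rewrite !inE e'E neuv Uu au eqxx eav !orbT.
rewrite -/(N v) -/(N u); move: deg_uv deg_o; lia.
Qed.

Lemma clique_minor_contract h e U u v : symmetric e ->
  u \in U -> v \in U -> e u v ->
  clique_minor h (contract e u v) (U :\ v) -> clique_minor h e U.
Proof.
move=> sym_e Uu Uv euv.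
apply: (clique_minor_lift (beta := fun a => if a == u then [set u; v] else [set a])).
- move=> a; rewrite !inE => /andP[av Ua]; case: ifP => _; rewrite ?sub1set //.
  by apply/subsetP => z /set2P[]->.
- by move=> a _; case: ifP => _; [apply: connected_in2 | apply: connected_in1].
- move=> a b; rewrite !inE => /andP[av Ua] /andP[bv Ub] ab.
  case: (a =P u) => [au|/eqP au]; case: (b =P u) => [bu|/eqP bu].
  + by rewrite au bu eqxx in ab.
  + by rewrite disjoint_sym disjoints1 !inE negb_or bu bv.
  + by rewrite disjoints1 !inE negb_or au av.
  + by rewrite disjoints1 !inE.
- move=> a b _ _ /andP[ab /or3P[eab|/andP[/eqP-> evb]|/andP[/eqP-> eav]]].
  + exists a, b; split=> //.
      by case: ifP => [/eqP->|_]; rewrite !inE eqxx.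
    by case: ifP => [/eqP->|_]; rewrite !inE eqxx.
  + exists v, b; split=> //; first by rewrite eqxx !inE eqxx orbT.
    by case: ifP => [/eqP->|_]; rewrite !inE eqxx.
  + exists a, v; split=> //; last by rewrite eqxx !inE eqxx orbT.
    by case: ifP => [/eqP->|_]; rewrite !inE eqxx.
Qed.

(** The apex [v] becomes a branch set of its own, at index [ord0]; the other branch sets are
    nonempty and lie in its neighbourhood, so it is joined to each of them. *)
Lemma clique_minor_cone h e U v : symmetric e -> irreflexive e -> v \in U ->
  clique_minor h e (nbr_in e U v) -> clique_minor h.+1 e U.
Proof.
move=> sym_e irr_e Uv [B [sB cB dB aB]].
have notBv i : v \notin B i.
  by apply/negP => /(subsetP (sB i)); rewrite inE irr_e andbF.
exists (fun i => if unlift ord0 i is Some j then B j else [set v]).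
split=> [i|i|i j|i j].
- case: unliftP => [k _|_]; last by rewrite sub1set.
  by apply: subset_trans (sB k) _; apply/subsetP => z; rewrite inE => /andP[].
- by case: unliftP => [k _|_]; [apply: cB | apply: connected_in1].
- case: unliftP => [k ->|->]; case: unliftP => [l ->|->] ij.
  + by apply: dB; apply: contraNneq ij => ->.
  + by rewrite disjoint_sym disjoints1.
  + by rewrite disjoints1.
  + by rewrite eqxx in ij.
- have adj k : exists2 u, u \in B k & e v u.
    have [/set0Pn[u Bu] _] := cB k; exists u => //.
    by move/(subsetP (sB k)): Bu; rewrite inE => /andP[].
  case: unliftP => [k ->|->]; case: unliftP => [l ->|->] ij.
  + by apply: aB; apply: contraNneq ij => ->.
  + by have [u Bu evu] := adj k; exists u, v; rewrite inE sym_e.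
  + by have [u Bu evu] := adj l; exists v, u; rewrite inE.
  + by rewrite eqxx in ij.
Qed.

(* Mader: an edge with few common neighbours may be contracted, and if there is
   no such edge then every neighbourhood induces a dense graph. *)
Lemma dense_clique_minor h e U : symmetric e -> irreflexive e ->
  U != set0 -> 2 ^ h.+1 * #|U| <= arcs e U -> clique_minor h e U.
Proof.
elim: h e U => [|h IHh] e U.
  by move=> *; exists (fun=> set0); split=> [[]|[]|[]|[]].
have [m] := ubnP #|U|; elim: m e U => // m IHm e U leUm sym_e irr_e U0 dense.
have [/existsP[u /andP[Uu /existsP[v /andP[Uv /andP[euv few]]]]]|many] :=
  boolP [exists u in U, exists v in U,
           e u v && (#|nbr_in e U u :&: nbr_in e U v| < 2 ^ h.+1)].
  apply: (clique_minor_contract sym_e Uu Uv euv); apply: IHm.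
  - by move: leUm; rewrite (cardsD1 v) Uv.
  - exact: contract_sym.
  - by move=> a; rewrite /contract /= eqxx.
  - apply/set0Pn; exists u; rewrite !inE Uu andbT.
    by apply: contraTneq euv => ->; rewrite irr_e.
  (* With fewer than [2 ^ h.+1] common neighbours at most [2 ^ h.+2] arcs are lost, which is what
     one vertex less allows. *)
  - have := arcs_contract sym_e irr_e Uu Uv euv.
    move: dense few; rewrite (cardsD1 v) Uv [2 ^ h.+2]expnS; lia.
have [v Uv /set0Pn W0] : exists2 v, v \in U & nbr_in e U v != set0.
  apply/exists_inP; apply: contraTT dense => /exists_inPn no.
  rewrite -ltnNge /arcs big1 => [|u Uu]; first by rewrite muln_gt0 expn_gt0 card_gt0.
  by apply/eqP; rewrite cards_eq0; apply: contraR (no u Uu) => ->.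
apply: (clique_minor_cone sym_e irr_e Uv); apply: IHh => //; first exact/set0Pn.
(* Every edge at [v] has at least [2 ^ h.+1] common neighbours, so this is a lower bound on all
   degrees inside the neighbourhood of [v]. *)
rewrite mulnC -sum_nat_const; apply: leq_sum => z; rewrite inE => /andP[Uz evz].
have -> : nbr_in e (nbr_in e U v) z = nbr_in e U v :&: nbr_in e U z.
  by apply/setP => y; rewrite !inE; case: (y \in U).
rewrite leqNgt; apply: contraNN many => few.
apply/existsP; exists v; rewrite Uv; apply/existsP; exists z.
by rewrite Uz evz.
Qed.

(** Peeling: some vertex has degree at most [d], since the average is smaller; its edges are
    oriented away from it, and the rest is oriented recursively. *)
Lemma sparse_orientation d e U : symmetric e ->
  (forall S, S \subset U -> S != set0 -> arcs e S < d * #|S|) ->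
  exists o : rel T,
    [/\ subrel o e, forall u, #|[set v | o u v]| <= d
      & {in U &, forall u v, e u v -> o u v || o v u}].
Proof.
move=> sym_e; have [m] := ubnP #|U|; elim: m U => // m IHm U leUm sparse.
have [->|U0] := eqVneq U set0.
  exists [rel _ _ | false]; split=> // [u|u v]; last by rewrite inE.
  by apply/leq_trans/(leq0n d); rewrite leqn0 cards_eq0; apply/eqP/setP=> v; rewrite !inE.
have [w Uw degw] : exists2 w, w \in U & #|nbr_in e U w| <= d.
  apply/exists_inP; apply: contraTT (sparse U (subxx _) U0) => /exists_inPn big.
  rewrite -leqNgt mulnC -sum_nat_const; apply: leq_sum => u Uu.
  by rewrite ltnW // ltnNge big.
have [||o [o_sub od oe]] := IHm (U :\ w).
- by move: leUm; rewrite (cardsD1 w) Uw.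
- by move=> S sS; apply: sparse; apply: subset_trans sS (subD1set _ _).
exists [rel u v | if u == w then (v \in U) && e w v else o u v].
split=> [u v|u|u v Uu Uv euv] /=.
  by have [->|_] := eqVneq u w; [case/andP | apply: o_sub].
  have [_|_] := eqVneq u w; last exact: od.
  by apply: leq_trans degw; apply/subset_leq_card/subsetP => v; rewrite !inE.
case: (u =P w) => [uw|/eqP uw]; first by rewrite Uv -uw euv.
case: (v =P w) => [vw|/eqP vw]; first by rewrite Uu -vw sym_e euv orbT.
by apply: oe; rewrite ?inE ?uw ?vw.
Qed.

End Density.

(** * Rounding the linear program *)

Lemma clique_minorW (T : finType) h (e : rel T) (U U' : {set T}) :
  U \subset U' -> clique_minor h e U -> clique_minor h e U'.
Proof.
by move=> sUU' [B [sB cB dB aB]]; exists B; split=> // i; apply: subset_trans sUU'.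
Qed.

(** A clique on [#|H|] vertices contains every graph on that many vertices, so the branch sets can
    be handed out by [enum_rank]. *)
Lemma clique_minor_minor (H G : sgraph) :
  clique_minor #|H| (@sedge G) [set: G] -> minor H G.
Proof.
case=> B [_ cB dB aB]; exists (fun a => B (enum_rank a)); split=> [a|a b ab|a b ab].
- exact: cB.
- by apply: dB; rewrite (inj_eq enum_rank_inj).
- apply: aB; rewrite (inj_eq enum_rank_inj).
  by apply: contraTneq ab => ->; rewrite sedge_irr.
Qed.

Section Rounding.
Variables (R : realFieldType) (G : sgraph) (h : nat).
Hypothesis no_clique : ~ clique_minor h (@sedge G) [set: G].
Hypothesis connG : connected_graph G.
Variables c x : G -> R.
Hypothesis c_ge0 : forall v, (0 <= c v)%R.
Hypothesis x_feas : lp_feasible x.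

Let d := 2 ^ h.+1.

Lemma sparse_sets (S : {set G}) : S != set0 -> arcs (@sedge G) S < d * #|S|.
Proof.
move=> S0; rewrite ltnNge; apply/negP => dense; apply: no_clique.
apply: clique_minorW (subsetT S) _.
by apply: dense_clique_minor => //; [apply: sedge_sym | apply: sedge_irr].
Qed.

Local Open Scope ring_scope.

Lemma lp_cost_ge0 : 0 <= lp_cost c x.
Proof. by case: x_feas => _ _ x0; apply: sumr_ge0 => v _; apply: mulr_ge0. Qed.

(** * Domination: heavy vertices and cheapest neighbours *)

Definition heavy : {set G} := [set v | 1 <= (2 * d.+1)%:R * x v].

(* In an orientation of out-degree at most d, a vertex with no heavy closed
   neighbour gets half of its LP coverage from its in-neighbours. *)
Lemma dominating_cost (D U : {set G}) (best : G -> G) :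
  D \subset heavy :|: best @: U ->
  {in U, forall v, forall u, u \in cnbr v -> u \notin heavy /\ c (best v) <= c u} ->
  cost c D <= (4 * d + 2)%:R * lp_cost c x.
Proof.
move=> sD Ubest; have [x_dom _ x_ge0] := x_feas.
have [|o [o_sub o_deg o_edge]] :=
  @sparse_orientation _ d (@sedge G) [set: G] (@sedge_sym G).
  by move=> S _; apply: sparse_sets.
have best_le v : v \in U -> c (best v) <= 2 * \sum_(u | o u v) c u * x u.
  move=> Uv; have light u : u \in cnbr v -> (2 * d.+1)%:R * x u < 1.
    by move=> /(Ubest v Uv)[]; rewrite inE -ltNge.
  (* [v] and its at most [d] out-neighbours are light; the threshold [1 / (2 * (d + 1))] leaves
     these [d + 1] vertices at most half of the coverage. *)
  have out_le : (2 * d.+1)%:R * (\sum_(u in cnbr v | (u == v) || o v u) x u) <= d.+1%:R.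
    rewrite mulr_sumr (le_trans (y := \sum_(u in v |: [set u | o v u]) 1)) //.
      rewrite big_mkcond [leRHS]big_mkcond /=; apply: ler_sum => u _.
      rewrite !inE; case: (boolP (u \in cnbr v)) => [Nu|Nu]; last first.
        by rewrite /cnbr !inE in Nu; rewrite (negPf Nu) /=; case: ifP.
      rewrite /cnbr !inE in Nu; rewrite Nu /=; case: ifP => // _.
      by apply/ltW/light; rewrite /cnbr !inE.
    rewrite sumr_const ler_nat cardsU1; move: (o_deg v).
    by case: (_ \notin _) => /=; lia.
  have in_ge : 1 <= 2 * \sum_(u | o u v) x u.
    have /(le_trans (x_dom v)) : \sum_(u in cnbr v) x u <=
        \sum_(u in cnbr v | (u == v) || o v u) x u + \sum_(u | o u v) x u.
      rewrite big_mkcond [X in _ <= X + _]big_mkcond [X in _ <= _ + X]big_mkcond /=.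
      rewrite -big_split /=; apply: ler_sum => u _.
      case: (boolP (u \in cnbr v)) => /= [|_]; last first.
        by rewrite add0r; case: ifP.
      rewrite !inE => /orP[->|/(o_edge v u (in_setT _) (in_setT _))].
        by rewrite /= lerDl; case: ifP.
      case: (u == v) => /=; first by rewrite lerDl; case: ifP.
      by case: (o v u) => /= [_|->]; rewrite ?lerDl ?add0r //; case: ifP.
    move: out_le; rewrite natrM; set A := \sum_(u in _ | _) x u.
    move=> out_le; have : 2 * A <= 1.
      rewrite -(ler_pM2l (_ : 0 < d.+1%:R)) ?ltr0Sn // mulr1.
      by rewrite mulrA [_ * 2]mulrC.
    by lra.
  apply: (le_trans (y := c (best v) * (2 * \sum_(u | o u v) x u))).
    by rewrite ler_peMr.
  rewrite mulrCA ler_pM2l ?ltr0n // mulr_sumr; apply: ler_sum => u ouv.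
  rewrite ler_wpM2r //; have [] // := Ubest v Uv u.
  by rewrite !inE sedge_sym o_sub ?orbT.
have heavy_le : cost c heavy <= (2 * d.+1)%:R * lp_cost c x.
  rewrite /cost big_mkcond /lp_cost mulr_sumr /=; apply: ler_sum => v _.
  rewrite inE; case: ifP => [hv|_]; last by rewrite !mulr_ge0.
  by rewrite mulrCA ler_peMr.
have image_le : cost c (best @: U) <= (2 * d)%:R * lp_cost c x.
  apply: (le_trans (y := \sum_(v in U) c (best v))).
    rewrite (partition_big_imset best) /=; apply: ler_sum => y /imsetP[v Uv ->].
    by rewrite (bigD1 v) ?Uv ?eqxx //= lerDl; apply: sumr_ge0.
  apply: (le_trans (y := \sum_v 2 * \sum_(u | o u v) c u * x u)).
    rewrite [leLHS]big_mkcond /=; apply: ler_sum => v _.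
    case: ifP => [/best_le //|_]; apply: mulr_ge0 => //.
    by apply: sumr_ge0 => u _; apply: mulr_ge0.
  (* Summed over all [v], a vertex [u] is charged once per out-neighbour, hence at most [d]
     times. *)
  rewrite -mulr_sumr (exchange_big_dep predT) //= natrM -mulrA ler_pM2l ?ltr0n //.
  rewrite /lp_cost mulr_sumr; apply: ler_sum => u _.
  rewrite sumr_const -[leLHS]mulr_natl ler_wpM2r ?mulr_ge0 // ler_nat.
  by apply: leq_trans (o_deg u); rewrite cardsE.
have D_le : cost c D <= cost c heavy + cost c (best @: U).
  rewrite /cost big_mkcond [X in _ <= X + _]big_mkcond [X in _ <= _ + X]big_mkcond.
  rewrite -big_split /=; apply: ler_sum => v _; case: ifP => [Dv|_].
    have /setUP[->|->] := subsetP sD v Dv; rewrite ?lerDl ?lerDr //; case: ifP => //.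
  by apply: addr_ge0; case: ifP.
apply: le_trans D_le _; apply: le_trans (lerD heavy_le image_le) _.
by rewrite -mulrDl ler_wpM2r ?lp_cost_ge0 // -natrD ler_nat; lia.
Qed.

(* The connection phase: [X] is the set of bought vertices, [K] the vertices that
   are kept, and [lab] maps a vertex to the representative of its component. *)
Definition label_inv (X K : {set G}) (lab : G -> G) : Prop :=
  [/\ K \subset X, forall v, lab v \in K, forall v, lab (lab v) = lab v
    & forall v, connect (induced (v |: K)) v (lab v)].

Definition label_closed (X : {set G}) (lab : G -> G) : Prop :=
  {in X &, forall u v, sedge u v -> lab u = lab v}.

Definition labels (lab : G -> G) : {set G} := [set lab v | v : G].

Definition relabel (lab : G -> G) a b : G -> G :=
  fun z => if lab z == a then b else lab z.

Definition touches (X : {set G}) (lab : G -> G) w a : bool :=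
  [exists u in X, (lab u == a) && sedge u w].

(** The number of components that pay for [w] at once: if each offers [t], then [w] collects
    [t * ldeg X lab w]. Bought vertices collect nothing. *)
Definition ldeg (X : {set G}) (lab : G -> G) w : nat :=
  if w \in X then 0%N else #|[set a | touches X lab w a]|.

(* Local ratio: [r] is the residual of the costs [c], rescaled by [s], and every
   set that may still become the final [K] pays for the difference. *)
Definition price_inv (D X K : {set G}) (lab : G -> G) (r : G -> R) (s : R) : Prop :=
  [/\ 0 < s, forall v, 0 <= r v, forall v, v \in X -> r v = 0
    & forall T : {set G}, K \subset T -> (#|T| + 2 <= #|K| + 2 * #|labels lab|)%N ->
        s * cost c (T :\: D)
          <= (3 * d)%:R * (s * lp_cost c x - lp_cost r x) + cost r T].

Lemma price_inv_ext D X K lab r r' s : (forall v, r' v = r v) ->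
  price_inv D X K lab r s -> price_inv D X K lab r' s.
Proof.
move=> rr' [s0 r0 rX main]; split=> // [v|v Xv|T sKT leT].
- by rewrite rr'.
- by rewrite rr' rX.
have -> : lp_cost r' x = lp_cost r x by apply: eq_bigr => v _; rewrite rr'.
have -> : cost r' T = cost r T by apply: eq_bigr => v _; rewrite rr'.
exact: main.
Qed.

Lemma induced_connect_sym S : connect_sym (@induced G S).
Proof. by apply: sym_connect_sym => u v; rewrite /induced /= sedge_sym andbCA. Qed.

Lemma label_in_labels lab v : lab v \in labels lab.
Proof. exact: imset_f. Qed.

Lemma label_inv_init (D : {set G}) lab :
  (forall v, v \in D -> lab v = v) ->
  (forall v, v \notin D -> lab v \in D /\ sedge v (lab v)) ->
  label_inv D D lab.
Proof.
move=> labD labN; have Dlab v : lab v \in D.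
  by have [Dv|/labN[]//] := boolP (v \in D); rewrite labD.
split=> // v; first exact: labD.
have [Dv|/labN[_ e]] := boolP (v \in D); first by rewrite labD.
by apply: connect1; apply/and3P; split; rewrite // !inE ?eqxx // Dlab orbT.
Qed.

(** No price has been paid: the two costs of [T] agree term by term, and setting the residual cost
    to zero on [D] only lowers its LP value. *)
Lemma price_inv_init (D : {set G}) lab s : 0 < s ->
  price_inv D D D lab (fun v => if v \in D then 0 else s * c v) s.
Proof.
have [_ _ x_ge0] := x_feas.
move=> s0; split=> // [v|v ->//|T _ _].
  by case: ifP => // _; rewrite mulr_ge0 // ltW.
have -> : s * cost c (T :\: D) = cost (fun v => if v \in D then 0 else s * c v) T.
  rewrite /cost mulr_sumr big_mkcond [RHS]big_mkcond /=; apply: eq_bigr => v _.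
  by rewrite !inE; case: (v \in D); case: (v \in T).
rewrite lerDr mulr_ge0 ?ler0n // subr_ge0 /lp_cost mulr_sumr.
apply: ler_sum => v _; case: ifP => _; last by rewrite mulrA.
by rewrite mul0r !mulr_ge0 // ltW.
Qed.

(** A vertex [z] that changes its label reaches the new one via [lab u], [u], [v] and [lab v];
    keeping [u] and [v] is what makes this walk available. *)
Lemma merge_label_inv X K lab u v :
  label_inv X K lab -> u \in X -> v \in X -> sedge u v -> lab u != lab v ->
  label_inv X (u |: (v |: K)) (relabel lab (lab u) (lab v)).
Proof.
move=> [sKX labK labI labC] Xu Xv euv neuv; split.
- by apply/subsetP => z /setU1P[->//|/setU1P[->//|/(subsetP sKX)]].
- by move=> z; rewrite /relabel; case: ifP => _; rewrite !inE labK !orbT.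
- move=> z; rewrite /relabel; case: (lab z =P lab u) => [_|/eqP zu].
    by rewrite labI eq_sym (negPf neuv).
  by rewrite labI (negPf zu).
move=> z; have sub y : y \in [:: u; v; z] ->
    forall a b, connect (induced (y |: K)) a b ->
    connect (induced (z |: (u |: (v |: K)))) a b.
  move=> yin a b; apply: restr_rel_sub; apply/subsetP => t.
  rewrite !inE in yin *; case/or3P: yin => /eqP -> /orP[->|->]; rewrite ?orbT //.
rewrite /relabel; case: (lab z =P lab u) => [zu|_]; last first.
  by apply: (sub z); rewrite ?inE ?eqxx ?orbT.
apply: connect_trans (_ : connect _ z (lab z)) _.
  by apply: (sub z); rewrite ?inE ?eqxx ?orbT.
rewrite zu; apply: connect_trans (_ : connect _ (lab u) u) _.
  by rewrite induced_connect_sym; apply: (sub u); rewrite ?inE ?eqxx ?orbT.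
apply: (@connect_trans _ _ v); last first.
  by apply: (sub v); rewrite ?inE ?eqxx ?orbT.
by apply: connect1; apply/and3P; split; rewrite // !inE ?eqxx ?orbT.
Qed.

Lemma card_labels_relabel lab u v : lab u != lab v ->
  (#|labels (relabel lab (lab u) (lab v))| < #|labels lab|)%N.
Proof.
move=> neuv; apply: proper_card; apply/properP; split.
  by apply/subsetP => _ /imsetP[z _ ->]; rewrite /relabel; case: ifP; rewrite label_in_labels.
exists (lab u); first exact: label_in_labels.
apply/imsetP => -[z _]; rewrite /relabel; case: ifP => [_ uv|/eqP zu /esym //].
by rewrite uv eqxx in neuv.
Qed.

(** [K] gains at most two vertices while a label is lost, so [#|K| + 2 * #|labels lab|] does not
    grow and any [T] admissible now was admissible before. *)
Lemma merge_price_inv D X K lab r s u v :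
  price_inv D X K lab r s -> lab u != lab v ->
  price_inv D X (u |: (v |: K)) (relabel lab (lab u) (lab v)) r s.
Proof.
move=> [s0 r0 rX main] neuv; split=> // T sT leT; apply: main.
  by apply: subset_trans sT; rewrite setUA subsetUr.
have := card_labels_relabel neuv; move: leT.
by rewrite !cardsU1; do 2!case: (_ \notin _) => /=; lia.
Qed.

Lemma relabel_eq lab a b u v :
  lab u = lab v -> relabel lab a b u = relabel lab a b v.
Proof. by rewrite /relabel => ->. Qed.

(** * Components of the bought set, their boundaries and prices *)

Section Closed.
Variables (X K : {set G}) (lab : G -> G).
Hypothesis inv : label_inv X K lab.

(** The label invariant makes [K] dominating: the walk from [w] outside [K] to its label starts with
    an edge into [K], and the component of that vertex touches [w]. So the ratios
    [r w / ldeg X lab w] make sense. *)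
Lemma ldeg_gt0 w : w \notin X -> (0 < ldeg X lab w)%N.
Proof.
case: inv => sKX labK _ labC Xw.
have Kw : w \notin K by apply: contraNN Xw; apply: (subsetP sKX).
have /connectP[[|y p] /=] := labC w.
  by move=> _ lw; rewrite -lw labK in Kw.
case/andP=> /and3P[_ wKy ewy] _ _; rewrite /ldeg (negPf Xw) card_gt0.
have Ky : y \in K.
  by case/setU1P: wKy ewy => // ->; rewrite sedge_irr.
apply/set0Pn; exists (lab y); rewrite inE; apply/exists_inP; exists y.
  exact: (subsetP sKX).
by rewrite eqxx sedge_sym.
Qed.

Hypothesis clos : label_closed X lab.

Let class a : {set G} := [set u in X | lab u == a].

(** Closure forbids a change of label along an edge inside [X], so a walk in [X] never leaves its
    class. *)
Lemma label_path (S : {set G}) u v : S \subset X -> connect (induced S) u v ->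
  lab v = lab u /\ (u \in X -> connect (induced (class (lab u))) u v).
Proof.
move=> /subsetP sSX /connectP[p]; elim: p u => [|y p IH] u /=.
  by move=> _ ->; split.
case/andP=> /and3P[Su Sy euy] /IH{}IH /IH[-> conn].
have labuy : lab u = lab y by apply: clos; rewrite ?sSX.
split=> // _; rewrite labuy; apply: connect_trans (conn (sSX _ Sy)).
by apply: connect1; apply/and3P; split=> //; rewrite inE sSX // ?labuy eqxx.
Qed.

Lemma class_connected a : a \in labels lab -> connected_set (class a).
Proof.
case: inv => sKX labK labI labC /imsetP[v _ ->].
have toLab u : u \in X -> connect (induced (class (lab u))) u (lab u).
  move=> Xu; have sX : u |: K \subset X by rewrite subUset sub1set Xu.
  by have [_ /(_ Xu)] := label_path sX (labC u).
split.
  by apply/set0Pn; exists (lab v); rewrite inE labI eqxx (subsetP sKX).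
move=> u w; rewrite !inE => /andP[Xu /eqP luv] /andP[Xw /eqP lwv].
have := toLab u Xu; have := toLab w Xw; rewrite luv lwv => wv uv.
by apply: connect_trans uv _; rewrite induced_connect_sym.
Qed.

Lemma nbr_class a : nbr_set (class a) = [set w | (w \notin X) && touches X lab w a].
Proof.
apply/setP => w; rewrite !inE.
have -> : [exists u in class a, sedge u w] = touches X lab w a.
  by apply: eq_existsb => u; rewrite inE andbA.
have [/existsP[u /and3P[Xu /eqP ua euw]]|_] := boolP (touches X lab w a); last by rewrite !andbF.
rewrite !andbT; case: (boolP (w \in X)) => //= Xw.
by rewrite -ua (clos Xu Xw euw) eqxx.
Qed.

(** Each class indexes a connectivity constraint; adding these constraints counts [x w] once per
    class that touches [w]. *)
Lemma ldeg_lp : (1 < #|labels lab|)%N ->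
  #|labels lab|%:R <= \sum_w (ldeg X lab w)%:R * x w.
Proof.
case: inv => sKX labK labI labC L1; have [_ x_sep x_ge0] := x_feas.
have sep a : a \in labels lab -> 1 <= \sum_(w in nbr_set (class a)) x w.
  move=> La; have [b Lb ab] : exists2 b, b \in labels lab & b != a.
    have : (0 < #|labels lab :\ a|)%N by move: L1; rewrite (cardsD1 a) La.
    by case/card_gt0P => b; rewrite !inE => /andP[ba Lb]; exists b.
  have lab_lab z : z \in labels lab -> (z \in X) * (lab z = z).
    by case/imsetP=> v _ ->; rewrite labI (subsetP sKX).
  (* A second representative [b] shows that some vertex lies beyond the boundary of the class. *)
  have Sb : b \notin class a by rewrite inE lab_lab // lab_lab // andTb.
  have Nb : b \notin nbr_set (class a) by rewrite nbr_class inE lab_lab.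
  have [/set0Pn[u Su] _] := class_connected La.
  apply: x_sep; apply/and3P; split; first by apply/set0Pn; exists u.
    (* If the boundary were empty, a walk from [u] to [b] could never leave the class. *)
    have [_ /(_ u b (in_setT _) (in_setT _))/connectP[p]] := connG.
    move=> pth b_eq; apply: contraNneq Sb => N0; rewrite b_eq.
    elim: p {b_eq} u Su pth => //= y p IH u Su /andP[/and3P[_ _ euy]].
    apply: IH; apply/negPn/negP => Sy; have : y \in nbr_set (class a).
      by rewrite inE Sy; apply/exists_inP; exists u.
    by rewrite N0 inE.
  by apply/set0Pn; exists b; rewrite inE inE negb_or Sb.
apply: (le_trans (y := \sum_(a in labels lab) \sum_(w in nbr_set (class a)) x w)).
  by rewrite -sum1_card natr_sum; apply: ler_sum => a /sep.
rewrite (exchange_big_dep predT) //=; apply: ler_sum => w _.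
rewrite sumr_const -[leLHS]mulr_natl ler_wpM2r // ler_nat /ldeg.
case: ifP => Xw.
  rewrite leqn0 -leqn0 leqNgt; apply/card_gt0P => -[a].
  by rewrite unfold_in /= nbr_class inE Xw /= andbF.
apply: subset_leq_card; apply/subsetP => a; rewrite unfold_in /= nbr_class.
by rewrite !inE => /and3P[].
Qed.

(* The components of [G[X]] and the vertices of [T] outside [X] span a bipartite
   minor of [G] with at most three times as many vertices as there are labels. *)
Lemma ldeg_sum (T : {set G}) : K \subset T ->
  (#|T| + 2 <= #|K| + 2 * #|labels lab|)%N ->
  (\sum_(w in T) ldeg X lab w <= 3 * d * #|labels lab|)%N.
Proof.
case: inv => sKX labK labI labC sKT leT.
(* One vertex per component, named by its representative, and the unbought vertices of [T]; [beta]
   below expands a representative to its class. *)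
pose U : {set G} := labels lab :|: (T :\: X).
pose e' : rel G := [rel a b | [&& a \in X, b \notin X & touches X lab b a]
                           || [&& b \in X, a \notin X & touches X lab a b]].
have lab_lab z : z \in labels lab -> (z \in X) * (lab z = z).
  by case/imsetP=> v _ ->; rewrite labI (subsetP sKX).
have touches_lab w a : touches X lab w a -> a \in labels lab.
  by case/existsP=> u /and3P[_ /eqP <- _]; apply: label_in_labels.
have UX a : a \in U -> a \in X -> a \in labels lab.
  by rewrite !inE => /orP[//|/andP[/negPf->]].
have no_dense : (arcs e' U < d * #|U|)%N.
  rewrite ltnNge; apply/negP => dense; apply: no_clique.
  pose beta a : {set G} := if a \in X then class a else [set a].
  apply: (@clique_minor_lift _ h _ _ e' U beta) => [a _|a Ua|a b Ua Ub ab|a b Ua Ub|].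
  - exact: subsetT.
  - rewrite /beta; case: ifP => Xa; last exact: connected_in1.
    by apply: class_connected; apply: UX.
  - rewrite -setI_eq0; apply: contraNT ab => /set0Pn[z]; rewrite /beta.
    case: ifP => Xa; case: ifP => Xb; rewrite !inE.
    + by case/andP=> /andP[_ /eqP<-] /andP[_ /eqP<-].
    + by case/andP=> /andP[Xz _] /eqP zb; rewrite -zb Xz in Xb.
    + by case/andP=> /eqP za /andP[Xz _]; rewrite -za Xz in Xa.
    + by case/andP=> /eqP<- /eqP<-.
  - have adj y w : y \in X -> w \notin X -> touches X lab w y ->
        exists u v, [/\ u \in beta y, v \in beta w & sedge u v].
      move=> Xy Xw /existsP[u /and3P[Xu lu euw]]; exists u, w.
      by rewrite /beta Xy (negPf Xw) !inE Xu lu eqxx.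
    case/orP=> /and3P[Xa Xb tab]; first exact: adj.
    have [u [v [ub va euv]]] := adj _ _ Xa Xb tab.
    by exists v, u; rewrite sedge_sym.
  - apply: dense_clique_minor => //.
    + by move=> a b; rewrite /e' /= orbC.
    + by move=> a; rewrite /e' /= orbb; case: (a \in X).
    + have [/set0Pn[v _] _] := connG.
      by apply/set0Pn; exists (lab v); rewrite inE label_in_labels.
(* The rows of the unbought vertices suffice: the row of [w] contains the labels of all components
   touching [w]. *)
apply: (@leq_trans (arcs e' U)).
  rewrite /arcs big_mkcond [leqRHS]big_mkcond /=; apply: leq_sum => w _.
  rewrite /ldeg; case: ifP => // Tw; case: ifP => // /negbT Xw.
  have Uw : w \in U by rewrite !inE Tw Xw orbT.
  rewrite Uw; apply: subset_leq_card; apply/subsetP => a; rewrite inE => taw.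
  have La := touches_lab _ _ taw.
  by rewrite !inE /e' La /= (lab_lab a La) Xw taw orbT.
apply: leq_trans (ltnW no_dense) _.
(* With [L] labels, [U] has at most [L] representatives and [#|T :\: K| <= 2 * L - 2] other
   vertices, whence the factor 3. *)
rewrite -mulnA mulnCA leq_mul2l; apply/orP; right.
apply: (@leq_trans (#|labels lab| + #|T :\: X|)); first by rewrite cardsU leq_subr.
have : (#|T :\: X| <= #|T :\: K|)%N by apply: subset_leq_card; apply: setDS.
have := cardsID K T; rewrite (setIidPr sKT) => TK.
by move: leT; rewrite -TK; lia.
Qed.

(** The price per component is [r w / ldeg X lab w], the largest that keeps all residual costs
    nonnegative; scaling by [ldeg X lab w] clears the denominator. A unit price lowers [cost r T] by
    the degrees in [T] and [lp_cost r x] by the degrees weighted with [x], so it is enough to bound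
    the former by [3 * d] times the latter. *)
Lemma price_step D r s w : price_inv D X K lab r s -> w \notin X ->
  (forall v, v \notin X -> r w * (ldeg X lab v)%:R <= r v * (ldeg X lab w)%:R) ->
  price_inv D (w |: X) K lab
    (fun v => (ldeg X lab w)%:R * r v - r w * (ldeg X lab v)%:R)
    ((ldeg X lab w)%:R * s).
Proof.
case: (inv) => sKX _ _ _ [s0 r0 rX main] Xw wmin.
have k0 : 0 < (ldeg X lab w)%:R :> R by rewrite ltr0n ldeg_gt0.
have [_ _ x_ge0] := x_feas.
split=> [|v|v|T sKT leT].
- exact: mulr_gt0.
- have [Xv|Xv] := boolP (v \in X).
    by rewrite rX // /ldeg Xv !mulr0 subr0.
  by rewrite subr_ge0 [_ * r v]mulrC wmin.
- case/setU1P=> [->|Xv]; first by rewrite mulrC subrr.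
  by rewrite rX // /ldeg Xv !mulr0 subr0.
set k := (ldeg X lab w)%:R in k0 *; set m := r w.
have -> : cost (fun v => k * r v - m * (ldeg X lab v)%:R) T =
    k * cost r T - m * (\sum_(v in T) ldeg X lab v)%N%:R.
  by rewrite /cost natr_sum !mulr_sumr -sumrB.
have -> : lp_cost (fun v => k * r v - m * (ldeg X lab v)%:R) x =
    k * lp_cost r x - m * \sum_v (ldeg X lab v)%:R * x v.
  rewrite /lp_cost !mulr_sumr -sumrB; apply: eq_bigr => v _.
  by rewrite mulrBl !mulrA.
set degx := \sum_v _; set degT := (\sum_(v in T) _)%N.
have degTx : degT%:R <= (3 * d)%:R * degx.
  (* With at most one label nothing remains to be kept: [T = K] lies in [X], where all degrees
     vanish. *)
  have [L1|L1] := leqP #|labels lab| 1.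
    have TK : T = K by apply/esym/eqP; rewrite eqEcard sKT; move: leT; lia.
    rewrite /degT big1 => [|v Tv]; last by rewrite /ldeg (subsetP sKX) // -TK.
    by rewrite mulr_ge0 ?ler0n ?sumr_ge0 // => v _; rewrite mulr_ge0.
  apply: le_trans (_ : (3 * d * #|labels lab|)%:R <= _).
    by rewrite ler_nat ldeg_sum.
  by rewrite natrM ler_wpM2l ?ler0n ?ldeg_lp.
have m0 : 0 <= m by apply: r0.
have := main T sKT leT; rewrite -(ler_pM2l k0) => main'.
have := ler_wpM2l m0 degTx.
rewrite -!mulrA; move: main'; set B := (3 * d)%:R; lra.
Qed.

End Closed.

(** Connectivity of [G] leaves a single label once everything is bought. The walks to the label
    connect [K], since [v |: K] is [K] for [v] in [K]. *)
Lemma cds_of_labels K lab : label_inv [set: G] K lab ->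
  label_closed [set: G] lab -> cds K /\ (#|labels lab| <= 1)%N.
Proof.
move=> inv clos; case: (inv) => _ labK labI labC; have [/set0Pn[v0 _] connT] := connG.
have lab_eq u v : lab u = lab v.
  by have [] := label_path clos (subsetT _) (connT u v (in_setT _) (in_setT _)).
split; first split.
(* The same invariant read with [K] in place of [X]: a positive degree of [v] yields a neighbour in
   [K]. *)
- move=> v Kv; have := ldeg_gt0 (X := K) (K := K) (lab := lab) _ Kv.
  rewrite /ldeg (negPf Kv) => /(_ (And4 (subxx _) labK labI labC)).
  case/card_gt0P=> a; rewrite inE => /existsP[u /and3P[Ku _ euv]].
  by exists u; rewrite // sedge_sym.
- split=> [|u v Ku Kv]; first by apply/set0Pn; exists (lab v0).
  have toLab z : z \in K -> connect (induced K) z (lab z).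
    by move=> Kz; have := labC z; rewrite (setUidPr _) // sub1set.
  apply: connect_trans (toLab u Ku) _.
  by rewrite (lab_eq u v) induced_connect_sym toLab.
rewrite (leq_trans (subset_leq_card (_ : labels lab \subset [set lab v0]))) ?cards1 //.
by apply/subsetP => _ /imsetP[v _ ->]; rewrite inE (lab_eq v v0).
Qed.

(** [K] itself is within the budget and all residual costs are zero, so the scale [s] cancels. *)
Lemma price_inv_final D K lab r s : price_inv D [set: G] K lab r s ->
  (#|labels lab| <= 1)%N -> cost c (K :\: D) <= (3 * d)%:R * lp_cost c x.
Proof.
move=> [s0 r0 rX main] L1; have [_ _ x_ge0] := x_feas.
have L1' : #|labels lab| = 1%N.
  apply/eqP; rewrite eqn_leq L1 card_gt0; have [/set0Pn[v0 _] _] := connG.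
  by apply/set0Pn; exists (lab v0); apply: label_in_labels.
have := main K (subxx _); rewrite L1' => /(_ (leqnn _)).
have -> : cost r K = 0 by apply: big1 => v _; apply: rX.
have -> : lp_cost r x = 0 by apply: big1 => v _; rewrite rX ?mul0r.
by rewrite subr0 addr0 mulrCA ler_pM2l.
Qed.

Lemma total_cost D K lab r s : cost c D <= (4 * d + 2)%:R * lp_cost c x ->
  label_inv [set: G] K lab -> label_closed [set: G] lab ->
  price_inv D [set: G] K lab r s ->
  cds K /\ cost c K <= (7 * d + 2)%:R * lp_cost c x.
Proof.
move=> D_le inv clos pinv; have [cdsK L1] := cds_of_labels inv clos; split=> //.
apply: (le_trans (y := cost c D + cost c (K :\: D))).
  rewrite /cost (big_setID D) /= lerD2r big_mkcond [leRHS]big_mkcond /=.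
  by apply: ler_sum => v _; rewrite inE; case: (v \in D); rewrite ?andbF ?andbT //; case: ifP.
apply: le_trans (lerD D_le (price_inv_final pinv L1)) _.
by rewrite -mulrDl -natrD; have -> : (4 * d + 2 + 3 * d = 7 * d + 2)%N by lia.
Qed.

Lemma merge_all D X K lab r s : label_inv X K lab -> price_inv D X K lab r s ->
  exists K' lab', [/\ label_inv X K' lab', price_inv D X K' lab' r s
                    & label_closed X lab'].
Proof.
have [m] := ubnP #|labels lab|; elim: m K lab => // m IH K lab ltm inv pinv.
have [/existsP[u /andP[Xu /existsP[v /and3P[Xv euv neuv]]]]|closed] :=
  boolP [exists u in X, exists v in X, sedge u v && (lab u != lab v)].
  apply: (IH (u |: (v |: K)) (relabel lab (lab u) (lab v))).
  - exact: leq_trans (card_labels_relabel neuv) _.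
  - exact: merge_label_inv.
  - exact: merge_price_inv.
exists K, lab; split=> // u v Xu Xv euv; apply/eqP; apply: contraNT closed => neuv.
by apply/existsP; exists u; rewrite Xu; apply/existsP; exists v; rewrite Xv euv.
Qed.

(** The abstract run for part (i): it buys a vertex of least ratio [r v / ldeg X lab v] until none
    is left. The program follows the same steps on natural numbers. *)
Lemma connect_all D X K lab r s : label_inv X K lab -> price_inv D X K lab r s ->
  exists K' lab' r' s', [/\ label_inv [set: G] K' lab',
    price_inv D [set: G] K' lab' r' s' & label_closed [set: G] lab'].
Proof.
have [m] := ubnP #|~: X|; elim: m X K lab r s => // m IH X K lab r s ltm inv pinv.
have {K lab inv pinv} [K [lab [inv pinv clos]]] := merge_all inv pinv.
have [XT|XT] := eqVneq X [set: G].
  by rewrite -XT; exists K, lab, r, s.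
have [w0 Xw0] : exists w0, w0 \in ~: X.
  by apply/set0Pn; apply: contraNneq XT => X0; rewrite -[X]setCK X0 setC0.
case: (@arg_minP _ R G w0 (mem (~: X)) (fun v => r v / (ldeg X lab v)%:R) Xw0).
move=> w /setCP/negP Xw wmin.
apply: (IH (w |: X) K lab).
- move: ltm; rewrite (cardsD1 w) inE Xw add1n ltnS; apply: leq_trans.
  by rewrite ltnS setCU setIC -setDE.
- case: inv => sKX labK labI labC; split=> //.
  exact: subset_trans sKX (subsetUr _ _).
- apply: (price_step inv clos pinv Xw) => v Xv.
  have vX : v \in ~: X by rewrite inE.
  have := wmin v vX.
  have k0 z : z \notin X -> 0 < (ldeg X lab z)%:R :> R.
    by move=> Xz; rewrite ltr0n (ldeg_gt0 inv).
  by rewrite ler_pdivrMr ?k0 // mulrAC ler_pdivlMr ?k0.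
Qed.

Lemma cds_rounding : exists K : {set G},
  cds K /\ cost c K <= (7 * d + 2)%:R * lp_cost c x.
Proof.
pose best v := [arg min_(u < v in cnbr v) c u]%O.
pose U : {set G} := [set v | [disjoint cnbr v & heavy]].
pose D := heavy :|: best @: U.
have bestP v : best v \in cnbr v /\ forall u, u \in cnbr v -> c (best v) <= c u.
  rewrite /best; case: arg_minP => [|z zv zmin]; first by rewrite !inE eqxx.
  by split=> // u; apply: zmin.
have D_le : cost c D <= (4 * d + 2)%:R * lp_cost c x.
  apply: (dominating_cost (U := U) (best := best)) => // v; rewrite inE => disj u vu.
  split; last by have [_ ->] := bestP v.
  by rewrite (disjointFr disj vu).
have dom v : exists2 u, u \in D & (u == v) || sedge v u.
  have [|] := boolP [disjoint cnbr v & heavy] => [Uv|].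
    exists (best v); first by rewrite inE imset_f ?orbT // inE.
    by have [+ _] := bestP v; rewrite !inE.
  rewrite -setI_eq0 => /set0Pn[u]; rewrite inE => /andP[vu hu]; exists u.
    by rewrite inE hu.
  by move: vu; rewrite !inE.
pose lab v := if v \in D then v else odflt v [pick u in D | sedge v u].
have labN v : v \notin D -> lab v \in D /\ sedge v (lab v).
  move=> Dv; rewrite /lab (negPf Dv); case: pickP => [u /andP[]//|no].
  have [u Du /orP[/eqP uv|evu]] := dom v; first by rewrite -uv Du in Dv.
  by have := no u; rewrite /= Du evu.
have inv : label_inv D D lab.
  by apply: label_inv_init => // v Dv; rewrite /lab Dv.
have [K [lab' [r' [s' [inv' pinv' clos']]]]] := connect_all inv (price_inv_init D lab ltr01).
by exists K; apply: total_cost D_le inv' clos' pinv'.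
Qed.

End Rounding.

(** * Programs with loops over the vertices *)

Section ForPrograms.

(* Every loop runs over the vertices: [FFor a p] executes [p] with cell 0 of bank
   [a] ranging over [0, ..., n - 1], where [n] is cell 0 of the input bank 0. *)
Inductive fcmd : Type :=
| FSkip
| FPut of nat & expr & expr
| FSeq of fcmd & fcmd
| FIf of expr & fcmd & fcmd
| FFor of nat & fcmd.

Definition var a := EGet a (EConst 0).

Definition loop_test a := ESub (var 0) (var a).
Definition loop_next a := EAdd (var a) (EConst 1).

Fixpoint compile (p : fcmd) : cmd :=
  match p with
  | FSkip => CSkip
  | FPut a e1 e2 => CPut a e1 e2
  | FSeq p q => CSeq (compile p) (compile q)
  | FIf e p q => CIf e (compile p) (compile q)
  | FFor a p =>
      CSeq (CPut a (EConst 0) (EConst 0))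
        (CWhile (loop_test a)
           (CSeq (compile p) (CPut a (EConst 0) (loop_next a))))
  end.

Fixpoint cwrites (p : cmd) : seq nat :=
  match p with
  | CSkip => [::]
  | CPut a _ _ => [:: a]
  | CSeq p q | CIf _ p q => cwrites p ++ cwrites q
  | CWhile _ p => cwrites p
  end.

Definition writes (p : fcmd) : seq nat := cwrites (compile p).

Definition agree_off (l : seq nat) (s s' : state) : Prop :=
  forall a, a \notin l -> forall i, s' a i = s a i.

(** The frame rule behind all later specifications. Banks are literals, so membership in the list of
    written banks is decided by computation, as in [(ag 4 isT)]. *)
Lemma exec_frame p s t s' : exec p s t s' -> agree_off (cwrites p) s s'.
Proof.
elim=> {p s t s'} //=.
- by move=> s a e1 e2 b; rewrite inE /update => /negPf->.
- move=> p q s s1 s2 t1 t2 _ IH1 _ IH2 a; rewrite mem_cat negb_or => /andP[pa qa] i.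
  by rewrite IH2 // IH1.
- move=> e p q s s' t _ _ IH a; rewrite mem_cat negb_or => /andP[pa qa] i.
  exact: IH.
- move=> e p q s s' t _ _ IH a; rewrite mem_cat negb_or => /andP[pa qa] i.
  exact: IH.
- by move=> e p s s1 s2 t1 t2 _ _ IH1 _ IH2 a pa i; rewrite IH2 // IH1.
Qed.

(** * Time bounds read off the program text *)

Fixpoint ewidth (e : expr) : nat :=
  match e with
  | EConst k => bitlen k
  | EGet _ e => 1
  | EAdd e1 e2 | ESub e1 e2 | EMul e1 e2 | EDiv e1 e2 => ewidth e1 + ewidth e2
  end.

Fixpoint ecost (e : expr) : nat :=
  ewidth e +
  match e with
  | EConst _ => 0
  | EGet _ e => ecost e
  | EAdd e1 e2 | ESub e1 e2 | EMul e1 e2 | EDiv e1 e2 => ecost e1 + ecost e2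
  end.

(** Time in units of [b], independent of the state: both branches of a test are added up. *)
Fixpoint pcost (p : fcmd) (n : nat) : nat :=
  match p with
  | FSkip => 1
  | FPut _ e1 e2 => ecost e1 + ecost e2
  | FSeq p q => pcost p n + pcost q n
  | FIf e p q => ecost e + (pcost p n + pcost q n)
  | FFor a p =>
      ecost (EConst 0) + ecost (EConst 0) +
      (n * (ecost (loop_test a) +
              (pcost p n + (ecost (EConst 0) + ecost (loop_next a))))
       + ecost (loop_test a))
  end.

Definition bounded b (s : state) : Prop := forall a i, s a i < 2 ^ b.

Lemma ltn_bitlen m : m < 2 ^ bitlen m.
Proof. exact: trunc_log_ltn. Qed.

Lemma bitlen_leq m k : 0 < k -> m < 2 ^ k -> bitlen m <= k.
Proof.
move=> k0 mk; rewrite /bitlen; case: m mk => [|m] mk; first by rewrite trunc_log0.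
rewrite -(ltn_exp2l _ _ (isT : 1 < 2)); apply: leq_ltn_trans mk.
exact: trunc_logP.
Qed.

Lemma ewidth_gt0 e : 0 < ewidth e.
Proof. by elim: e => //= e1 IH1 e2 IH2; rewrite addn_gt0 IH1. Qed.

(** A cell has at most [b] bits whatever its address, and no operation yields more bits than the
    bounds of its arguments have together; for a sum this needs both bounds to be at least 2. *)
Lemma eval_bounded b s e : 0 < b -> bounded b s -> eval s e < 2 ^ (b * ewidth e).
Proof.
move=> b0 bs; have lt2 e' : 1 < 2 ^ (b * ewidth e').
  by rewrite -[1](expn0 2) ltn_exp2l // muln_gt0 b0 ewidth_gt0.
elim: e => [k|a e IH|e1 IH1 e2 IH2|e1 IH1 e2 IH2|e1 IH1 e2 IH2|e1 IH1 e2 IH2] /=.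
- by apply: leq_trans (ltn_bitlen k) _; rewrite leq_exp2l // leq_pmull.
- by rewrite muln1.
- rewrite mulnDr expnD; move: IH1 IH2 (lt2 e1) (lt2 e2); nia.
- rewrite mulnDr expnD; move: IH1 IH2 (lt2 e1) (lt2 e2); nia.
- by rewrite mulnDr expnD ltn_mul.
- apply: leq_ltn_trans (leq_div _ _) _.
  by rewrite mulnDr expnD; apply: leq_trans IH1 _; rewrite leq_pmulr // expn_gt0.
Qed.

Lemma etime_bounded b s e : 0 < b -> bounded b s -> etime s e <= b * ecost e.
Proof.
move=> b0 bs; have len e' : bitlen (eval s e') <= b * ewidth e'.
  by apply: bitlen_leq; rewrite ?muln_gt0 ?b0 ?ewidth_gt0 // eval_bounded.
have bin f e1 e2 : ewidth (f e1 e2) = ewidth e1 + ewidth e2 ->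
    etime s e1 <= b * ecost e1 -> etime s e2 <= b * ecost e2 ->
    bitlen (eval s (f e1 e2)) + (etime s e1 + etime s e2) <=
    b * (ewidth e1 + ewidth e2 + (ecost e1 + ecost e2)).
  by move=> <- IH1 IH2; rewrite mulnDr [b * (ecost _ + _)]mulnDr !leq_add.
elim: e => [k|a e IH|e1 IH1 e2 IH2|e1 IH1 e2 IH2|e1 IH1 e2 IH2|e1 IH1 e2 IH2].
- by rewrite /= !addn0 (len (EConst k)).
- by rewrite [ecost _]/= mulnDr (leq_add (len (EGet a e)) IH).
- exact: (bin EAdd).
- exact: (bin ESub).
- exact: (bin EMul).
- exact: (bin EDiv).
Qed.

Variables (b n : nat).
Hypothesis b_gt0 : 0 < b.

(** Total correctness with the time and size bounds built in: what remains to check at each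
    assignment is that the stored value is below [2 ^ b]. *)
Definition wp (p : fcmd) (s : state) (Q : state -> Prop) : Prop :=
  exists t s', [/\ exec (compile p) s t s', t <= b * pcost p n,
                   bounded b s' & Q s'].

Lemma wp_conseq p s (Q Q' : state -> Prop) : wp p s Q ->
  (forall s', bounded b s' -> agree_off (writes p) s s' -> Q s' -> Q' s') ->
  wp p s Q'.
Proof.
move=> [t [s' [ex let_ bs' Qs']]] QQ'; exists t, s'; split=> //.
by apply: QQ' => //; apply: exec_frame ex.
Qed.

Lemma wp_skip s (Q : state -> Prop) : bounded b s -> Q s -> wp FSkip s Q.
Proof. by exists 1, s; split=> //; [apply: exec_Skip | rewrite muln1]. Qed.

Lemma bounded_update s a i k : bounded b s -> k < 2 ^ b -> bounded b (update s a i k).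
Proof. by move=> bs kb a' i'; rewrite /update; case: ifP. Qed.

Lemma wp_put a e1 e2 s (Q : state -> Prop) : bounded b s -> eval s e2 < 2 ^ b ->
  Q (update s a (eval s e1) (eval s e2)) -> wp (FPut a e1 e2) s Q.
Proof.
move=> bs e2b Qs; do 2!eexists; split; [exact: exec_Put | | | exact: Qs].
  by rewrite /= mulnDr leq_add ?etime_bounded.
exact: bounded_update.
Qed.

Lemma wp_seq p q s (Q : state -> Prop) :
  wp p s (fun s' => wp q s' Q) -> wp (FSeq p q) s Q.
Proof.
move=> [t1 [s1 [ex1 le1 bs1 [t2 [s2 [ex2 le2 bs2 Qs2]]]]]].
exists (t1 + t2), s2; split=> //; first exact: exec_Seq ex1 ex2.
by rewrite /= mulnDr leq_add.
Qed.

Lemma wp_if e p q s (Q : state -> Prop) : bounded b s ->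
  (eval s e != 0 -> wp p s Q) -> (eval s e = 0 -> wp q s Q) ->
  wp (FIf e p q) s Q.
Proof.
move=> bs wpp wpq; case: (eqVneq (eval s e) 0) => [e0|e0].
  have [t [s' [ex le bs' Qs']]] := wpq e0; exists (etime s e + t), s'; split=> //.
    exact: exec_IfF.
  rewrite /= mulnDr leq_add ?etime_bounded // mulnDr.
  exact: leq_trans le (leq_addl _ _).
have [t [s' [ex le bs' Qs']]] := wpp e0; exists (etime s e + t), s'; split=> //.
  exact: exec_IfT.
rewrite /= mulnDr leq_add ?etime_bounded // mulnDr.
exact: leq_trans le (leq_addr _ _).
Qed.

(** The side condition protects the counter and bank 0, which holds [n], from the body. [I] is
    asserted after the counter has been set, as the increment belongs to the round. *)
Lemma wp_for a p s (I : nat -> state -> Prop) (Q : state -> Prop) :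
  (0 \notin a :: writes p) && (a \notin writes p) ->
  s 0 0 = n -> bounded b s ->
  I 0 (update s a 0 0) ->
  (forall i s', i < n -> bounded b s' -> agree_off (a :: writes p) s s' ->
     s' a 0 = i -> I i s' ->
     wp p s' (fun s'' => I i.+1 (update s'' a 0 i.+1))) ->
  (forall s', bounded b s' -> agree_off (a :: writes p) s s' -> I n s' -> Q s') ->
  wp (FFor a p) s Q.
Proof.
rewrite inE negb_or => /andP[/andP[a0 p0] pa] sn bs I0 step fin.
have nb : n < 2 ^ b by rewrite -sn.
set w := CWhile (loop_test a) (CSeq (compile p) (CPut a (EConst 0) (loop_next a))).
have agree0 s' : agree_off (a :: writes p) s s' -> s' 0 0 = n.
  by move=> ag; rewrite ag // inE negb_or a0.
(* [k] is the number of rounds left, so the counter shows [n - k]. *)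
have loop k : forall s', k <= n -> bounded b s' -> agree_off (a :: writes p) s s' ->
    s' a 0 = n - k -> I (n - k) s' ->
    exists t s'', [/\ exec w s' t s'',
      t <= b * (k * (ecost (loop_test a) +
              (pcost p n + (ecost (EConst 0) + ecost (loop_next a))))
           + ecost (loop_test a)),
      bounded b s'', agree_off (a :: writes p) s s'' & I n s''].
  elim: k => [|k IH] s' kn bs' ag sa Is'.
    exists (etime s' (loop_test a)), s'; split=> //.
    - by apply: exec_WhileF; rewrite /= agree0 // sa subn0 subnn.
    - by rewrite mul0n add0n etime_bounded.
    - by rewrite subn0 in Is'.
  have kn' : n - k.+1 < n by lia.
  have [t1 [s1 [ex1 le1 bs1 Is1]]] := step _ _ kn' bs' ag sa Is'.
  have ag1 := exec_frame ex1.
  have s1a : s1 a 0 = n - k.+1 by rewrite ag1.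
  have next : eval s1 (loop_next a) = n - k by rewrite /= s1a; lia.
  have next_eq : (n - k.+1).+1 = n - k by lia.
  rewrite next_eq in Is1.
  have [|||||t2 [s2 [ex2 le2 bs2 ag2 Is2]]] := IH (update s1 a 0 (n - k)).
  - exact: ltnW.
  - by apply: bounded_update => //; apply: leq_ltn_trans nb; rewrite leq_subr.
  - move=> c; rewrite inE negb_or => /andP[ca pc] i.
    by rewrite /update (negPf ca) /= ag1 // ag // inE negb_or ca.
  - by rewrite /update !eqxx.
  - exact: Is1.
  exists (etime s' (loop_test a) + (t1 + (etime s1 (EConst 0) + etime s1 (loop_next a))) + t2), s2.
  split=> //.
    apply: exec_WhileT ex2; first by rewrite /= agree0 // sa; lia.
    apply: exec_Seq ex1 _; rewrite -next; exact: exec_Put.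
  have := etime_bounded (loop_test a) b_gt0 bs'.
  have := etime_bounded (EConst 0) b_gt0 bs1.
  have := etime_bounded (loop_next a) b_gt0 bs1.
  move: le1 le2; rewrite mulSn !mulnDr; lia.
have [|||||t [s' [ex le bs' ag Is']]] := loop n (update s a 0 0).
- exact: leqnn.
- by apply: bounded_update => //; rewrite expn_gt0.
- by move=> c; rewrite inE negb_or /update => /andP[/negPf->].
- by rewrite /update !eqxx subnn.
- by rewrite subnn.
exists (etime s (EConst 0) + etime s (EConst 0) + t), s'; split=> //; last exact: fin.
  apply: exec_Seq ex; exact: exec_Put.
have e0 := etime_bounded (EConst 0) b_gt0 bs.
have -> : pcost (FFor a p) n = ecost (EConst 0) + ecost (EConst 0) +
    (n * (ecost (loop_test a) + (pcost p n + (ecost (EConst 0) + ecost (loop_next a))))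
     + ecost (loop_test a)) by [].
by rewrite mulnDr leq_add // mulnDr leq_add.
Qed.

End ForPrograms.

(** The shape [A * n.+1 ^ k] absorbs a sum by adding coefficients and exponents, and a loop by one
    more power. *)
Lemma pcost_poly p : exists A k, forall n, pcost p n <= A * n.+1 ^ k.
Proof.
have mono A k A' k' n : A <= A' -> k <= k' -> A * n.+1 ^ k <= A' * n.+1 ^ k'.
  by move=> lA lk; rewrite leq_mul // leq_pexp2l.
have pos n k : 0 < n.+1 ^ k by rewrite expn_gt0.
elim: p => [|a e1 e2|p [A [k IHp]] q [A' [k' IHq]]|e p [A [k IHp]] q [A' [k' IHq]]
           |a p [A [k IHp]]].
- by exists 1, 0 => n.
- by exists (ecost e1 + ecost e2), 0 => n; rewrite muln1.
- exists (A + A'), (k + k') => n /=; rewrite mulnDl leq_add //.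
    by apply: leq_trans (IHp n) _; apply: mono; rewrite ?leq_addr.
  by apply: leq_trans (IHq n) _; apply: mono; rewrite ?leq_addl.
- exists (ecost e + (A + A')), (k + k') => n /=; rewrite !mulnDl; repeat apply: leq_add.
  + by rewrite leq_pmulr.
  + by apply: leq_trans (IHp n) _; apply: mono; rewrite ?leq_addr.
  + by apply: leq_trans (IHq n) _; apply: mono; rewrite ?leq_addl.
- set c0 := ecost (EConst 0); set ct := ecost (loop_test a); set ci := ecost (loop_next a).
  exists (c0 + c0 + (ct + (A + (c0 + ci)) + ct)), k.+1 => n.
  have -> : pcost (FFor a p) n =
    c0 + c0 + (n * (ct + (pcost p n + (c0 + ci))) + ct) by [].
  rewrite mulnDl; apply: leq_add; first by rewrite leq_pmulr.
  rewrite mulnDl; apply: leq_add; last by rewrite leq_pmulr.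
  rewrite expnS mulnCA leq_mul // mulnDl leq_add ?leq_pmulr //.
  by rewrite mulnDl leq_add ?IHp // leq_pmulr.
Qed.

Arguments wp_for {b n} b_gt0 {a p s} I {Q}.

(** * The algorithm *)

(** With truncated subtraction the inner sum is the distance of the two values, so the test is 1 on
    equality and 0 otherwise. *)
Definition eq_test e1 e2 := ESub (EConst 1) (EAdd (ESub e1 e2) (ESub e2 e1)).
Definition FWhen e p := FIf e p FSkip.
Definition FUnless e p := FIf e FSkip p.

(* Layout of the input: cell [1 + u n + v] of bank 0 is the adjacency bit of
   [u] and [v], and the column [k] of [n] cells starts at [1 + n (n + k)]. *)
Definition adj_at a b :=
  EGet 0 (EAdd (EConst 1) (EAdd (EMul (var a) (var 0)) (var b))).
Definition column k a :=
  EGet 0 (EAdd (EConst 1) (EAdd (EMul (var 0) (EAdd (var 0) (EConst k))) (var a))).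
Definition at_ a b := EGet a (var b).

(* Bank 1 holds the output, bank 2 the bought vertices, bank 3 the labels, bank 4
   the residual costs and bank 15 the degrees; the banks 10 to 14 are counters. *)

Definition denominators :=
  FSeq (FPut 5 (EConst 0) (EConst 1))
    (FFor 10 (FPut 5 (EConst 0) (EMul (var 5) (column 1 10)))).

Definition scale_costs :=
  FFor 10 (FPut 4 (var 10) (EMul (column 0 10) (EDiv (var 5) (column 1 10)))).

(** For [x v = xn v / xd v], the condition [1 <= Q * x v] reads [xd v <= Q * xn v]; truncated
    subtraction turns it into a bit. *)
Definition take_heavy Q :=
  FFor 10 (FPut 1 (var 10)
    (ESub (EConst 1) (ESub (column 3 10) (EMul (EConst Q) (column 2 10))))).

Definition scan_neighbours :=
  FFor 11 (FWhen (EAdd (adj_at 10 11) (eq_test (var 10) (var 11)))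
    (FSeq (FWhen (at_ 1 11) (FPut 7 (EConst 0) (EConst 1)))
          (FWhen (ESub (at_ 4 6) (at_ 4 11)) (FPut 6 (EConst 0) (var 11))))).

Definition dominate :=
  FFor 10
    (FSeq (FPut 6 (EConst 0) (var 10))
    (FSeq (FPut 7 (EConst 0) (EConst 0))
    (FSeq scan_neighbours
          (FUnless (var 7) (FPut 1 (var 6) (EConst 1)))))).

Definition find_dominator :=
  FFor 11 (FWhen (EMul (adj_at 10 11) (at_ 1 11)) (FPut 3 (var 10) (var 11))).

Definition init_labels :=
  FFor 10
    (FSeq (FPut 3 (var 10) (var 10))
    (FSeq (FPut 2 (var 10) (at_ 1 10))
          (FIf (at_ 1 10) (FPut 4 (var 10) (EConst 0)) find_dominator))).

Definition relabel_prog :=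
  FFor 14 (FWhen (eq_test (at_ 3 14) (var 8)) (FPut 3 (var 14) (var 9))).

(** Both labels are copied because relabelling overwrites the cells they come from. *)
Definition merge_pair :=
  FSeq (FPut 8 (EConst 0) (at_ 3 12))
  (FSeq (FPut 9 (EConst 0) (at_ 3 13))
  (FUnless (eq_test (var 8) (var 9))
    (FSeq (FPut 1 (var 12) (EConst 1))
    (FSeq (FPut 1 (var 13) (EConst 1)) relabel_prog)))).

Definition merge :=
  FFor 12 (FFor 13
    (FWhen (EMul (adj_at 12 13) (EMul (at_ 2 12) (at_ 2 13))) merge_pair)).

Definition touch_test :=
  FFor 13 (FWhen (EMul (adj_at 13 11) (EMul (at_ 2 13) (eq_test (at_ 3 13) (var 12))))
             (FPut 16 (EConst 0) (EConst 1))).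

Definition degree_of :=
  FFor 12 (FSeq (FPut 16 (EConst 0) (EConst 0))
          (FSeq touch_test (FPut 15 (var 11) (EAdd (at_ 15 11) (var 16))))).

Definition degrees :=
  FFor 11 (FSeq (FPut 15 (var 11) (EConst 0)) (FUnless (at_ 2 11) degree_of)).

(** The value [n] in bank 17 means that no candidate has been seen. Ratios are compared by cross
    multiplication. *)
Definition find_best :=
  FSeq (FPut 17 (EConst 0) (var 0))
    (FFor 11 (FUnless (at_ 2 11)
      (FIf (EAdd (eq_test (var 17) (var 0))
              (ESub (EMul (at_ 4 17) (at_ 15 11)) (EMul (at_ 4 11) (at_ 15 17))))
        (FPut 17 (EConst 0) (var 11)) FSkip))).

(** The residual cost of the chosen vertex is saved, as the loop sets it to zero before later
    vertices are updated. *)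
Definition buy :=
  FSeq (FPut 18 (EConst 0) (at_ 4 17))
  (FSeq (FPut 19 (EConst 0) (at_ 15 17))
  (FSeq (FFor 11 (FPut 4 (var 11)
           (ESub (EMul (var 19) (at_ 4 11)) (EMul (var 18) (at_ 15 11)))))
        (FPut 2 (var 17) (EConst 1)))).

(** Once everything is bought, [find_best] leaves the value [n] and further rounds buy nothing, so a
    fixed number of [n] rounds is safe. *)
Definition grow :=
  FFor 10 (FSeq degrees (FSeq find_best (FSeq (FWhen (ESub (var 0) (var 17)) buy) merge))).

Definition cds_program Q :=
  FSeq denominators (FSeq scale_costs (FSeq (take_heavy Q) (FSeq dominate
    (FSeq init_labels (FSeq merge grow))))).

Lemma updateE s a i k a' j :
  update s a i k a' j = if (a' == a) && (j == i) then k else s a' j.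
Proof. by []. Qed.

Lemma eq_testP s e1 e2 :
  (eval s (eq_test e1 e2) != 0) = (eval s e1 == eval s e2).
Proof. by rewrite /=; case: eqP => ?; lia. Qed.

Lemma wp_ifb b n e p q s (B : bool) (Q : state -> Prop) : 0 < b -> bounded b s ->
  (eval s e != 0) = B ->
  (B -> wp b n p s Q) -> (~~ B -> wp b n q s Q) -> wp b n (FIf e p q) s Q.
Proof.
move=> b0 bs eB wpp wpq; apply: wp_if => // [|e0]; first by rewrite eB.
by apply: wpq; rewrite -eB e0.
Qed.

(** * Specifications of the single loops *)

Section Program.
Variable G : sgraph.
Let n := #|G|.
Definition idx (v : G) : nat := enum_rank v.

Lemma idx_lt v : idx v < n. Proof. exact: ltn_ord. Qed.

Lemma idx_eq u v : (idx u == idx v) = (u == v).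
Proof. by rewrite (inj_eq val_inj) (inj_eq enum_rank_inj). Qed.

Lemma idx_surj i : i < n -> exists v, idx v = i.
Proof. by move=> ltin; exists (enum_val (Ordinal ltin)); rewrite /idx enum_valK. Qed.

Lemma idx_ltS i v u : idx u = i -> (idx v < i.+1) = (v == u) || (idx v < i).
Proof. by move=> <-; rewrite ltnS leq_eqVlt idx_eq. Qed.

Lemma forall_idx_ltS i u (P : G -> Prop) : idx u = i -> P u ->
  (forall v, idx v < i -> v != u -> P v) -> forall v, idx v < i.+1 -> P v.
Proof.
move=> ui Pu Pv v; rewrite (idx_ltS v ui); case: eqVneq => [->//|vu /= lt_vi].
exact: Pv.
Qed.

Variables cn cd xn xd : G -> nat.

Definition reads_input (s : state) : Prop :=
  [/\ s 0 0 = n,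
      forall u v, s 0 (1 + (idx u * n + idx v)) = sedge u v,
      forall v, s 0 (1 + (n * (n + 0) + idx v)) = cn v
                /\ s 0 (1 + (n * (n + 1) + idx v)) = cd v
    & forall v, s 0 (1 + (n * (n + 2) + idx v)) = xn v
                /\ s 0 (1 + (n * (n + 3) + idx v)) = xd v].

Lemma reads_input_agree s s' : reads_input s ->
  (forall i, s' 0 i = s 0 i) -> reads_input s'.
Proof.
by move=> [i1 i2 i3 i4] ag; split=> *; rewrite !ag; [apply: i1|apply: i2|apply: i3|apply: i4].
Qed.

Lemma eval_adj s a b u v : reads_input s -> s a 0 = idx u -> s b 0 = idx v ->
  eval s (adj_at a b) = sedge u v.
Proof. by move=> [i1 i2 _ _] /= -> ->; rewrite i1 i2. Qed.

Lemma eval_column s a v : reads_input s -> s a 0 = idx v ->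
  [/\ eval s (column 0 a) = cn v, eval s (column 1 a) = cd v,
      eval s (column 2 a) = xn v & eval s (column 3 a) = xd v].
Proof.
move=> [i1 _ /(_ v)[i2 i3] /(_ v)[i4 i5]] sa.
by split; rewrite /= sa i1.
Qed.

Definition holds_set a (S : {set G}) (s : state) : Prop :=
  forall v, (s a (idx v) != 0) = (v \in S).

Variable b : nat.
Hypothesis b_gt0 : 0 < b.
Hypothesis n_lt : n < 2 ^ b.
Notation wp := (wp b n).

Lemma one_lt : 1 < 2 ^ b.
Proof. by rewrite -[1](expn0 2) ltn_exp2l. Qed.

Lemma idx_ltb v : idx v < 2 ^ b.
Proof. exact: ltn_trans (idx_lt v) n_lt. Qed.

Hint Resolve one_lt idx_ltb b_gt0 : core.

Let P := \prod_v cd v.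
Hypothesis cd_gt0 : forall v, 0 < cd v.
Hypothesis P_lt : P < 2 ^ b.

Lemma prod_idx_leq i : \prod_(v | idx v < i) cd v <= P.
Proof.
rewrite /P [X in _ <= X](bigID (fun v => idx v < i)) /= leq_pmulr //.
exact: prodn_gt0.
Qed.

Lemma denominators_spec s : reads_input s -> bounded b s ->
  wp denominators s (fun s' => s' 5 0 = P).
Proof.
move=> inp bs; apply: wp_seq; apply: wp_put => //.
set s0 := update _ _ _ _.
have inp0 : reads_input s0 by apply: reads_input_agree inp _.
apply: (wp_for b_gt0 (fun i s => s 5 0 = \prod_(v | idx v < i) cd v)) => //.
- by case: inp0.
- exact: bounded_update.
- by rewrite big_pred0.
- move=> i s1 ltin bs1 ag s1i Is1; have [v vi] := idx_surj ltin.
  have inp1 : reads_input s1 by apply: reads_input_agree inp0 (ag 0 isT).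
  have [|_ cdE _ _] := eval_column (a := 10) (v := v) inp1; first by rewrite s1i vi.
  have prodS : s1 5 0 * cd v = \prod_(v | idx v < i.+1) cd v.
    rewrite (bigD1 v) /= ?vi // mulnC Is1; congr (_ * _); apply: eq_bigl => u.
    rewrite (idx_ltS u vi); case: eqVneq => [->|] /=; last by rewrite andbT.
    by rewrite vi ltnn.
  apply: wp_put => //; rewrite [eval _ (EMul _ _)]/= [s1 0 _]cdE prodS //.
  exact: leq_ltn_trans (prod_idx_leq _) P_lt.
- move=> s1 _ _ ->; rewrite /P; apply: eq_bigl => v; exact: idx_lt.
Qed.

Let cc v := cn v * (P %/ cd v).
Hypothesis cc_lt : forall v, cc v < 2 ^ b.

Lemma scale_costs_spec s : reads_input s -> bounded b s -> s 5 0 = P ->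
  wp scale_costs s (fun s' => forall v, s' 4 (idx v) = cc v).
Proof.
move=> inp bs s5.
apply: (wp_for b_gt0 (fun i s => forall v, idx v < i -> s 4 (idx v) = cc v)) => //.
- by case: inp.
- move=> i s1 ltin bs1 ag s1i Is1; have [v vi] := idx_surj ltin.
  have inp1 : reads_input s1 by apply: reads_input_agree inp (ag 0 isT).
  have [|cnE cdE _ _] := eval_column (a := 10) (v := v) inp1; first by rewrite s1i vi.
  have ccE : eval s1 (EMul (column 0 10) (EDiv (var 5) (column 1 10))) = cc v.
    by rewrite [eval _ _]/= [s1 0 _]cnE [s1 0 _]cdE (ag 5 isT) s5.
  apply: wp_put => //; rewrite ccE //=.
  apply: (forall_idx_ltS vi) => [|u ui uv]; first by rewrite !updateE /= s1i vi eqxx.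
  by rewrite !updateE /= s1i -vi idx_eq (negPf uv) Is1.
- by move=> s1 _ _ Is1 v; apply: Is1; apply: idx_lt.
Qed.

Variable Q : nat.
Let H : {set G} := [set v | xd v <= Q * xn v].

Lemma take_heavy_spec s : reads_input s -> bounded b s ->
  wp (take_heavy Q) s (holds_set 1 H).
Proof.
move=> inp bs.
apply: (wp_for b_gt0 (fun i s => forall v, idx v < i -> (s 1 (idx v) != 0) = (v \in H))) => //.
- by case: inp.
- move=> i s1 ltin bs1 ag s1i Is1; have [v vi] := idx_surj ltin.
  have inp1 : reads_input s1 by apply: reads_input_agree inp (ag 0 isT).
  have [|_ _ xnE xdE] := eval_column (a := 10) (v := v) inp1; first by rewrite s1i vi.
  set e := ESub _ _; have eE : eval s1 e = 1 - (xd v - Q * xn v).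
    by rewrite -xnE -xdE.
  apply: wp_put => //; rewrite eE; first by apply: leq_ltn_trans (leq_subr _ _) _.
  apply: (forall_idx_ltS vi) => [|u ui uv].
    by rewrite !updateE /= s1i vi eqxx inE; case: leqP; lia.
  by rewrite !updateE /= s1i -vi idx_eq (negPf uv) Is1.
- by move=> s1 _ _ Is1 v; apply: Is1; apply: idx_lt.
Qed.

Lemma scan_neighbours_spec s v (D : {set G}) :
  reads_input s -> bounded b s -> s 10 0 = idx v -> holds_set 1 D s ->
  (forall u, s 4 (idx u) = cc u) -> s 6 0 = idx v -> s 7 0 = 0 ->
  wp scan_neighbours s (fun s' =>
    [/\ exists z, [/\ s' 6 0 = idx z, z \in cnbr v & {in cnbr v, forall u, cc z <= cc u}]
      & (s' 7 0 != 0) = [exists u in cnbr v, u \in D]]).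
Proof.
move=> inp bs s10 sD s4 s6 s7.
apply: (wp_for b_gt0 (fun j s' =>
   (exists z, [/\ s' 6 0 = idx z, z \in cnbr v
      & forall u, u \in cnbr v -> idx u < j -> cc z <= cc u])
   /\ (s' 7 0 != 0) = [exists u in cnbr v, (idx u < j) && (u \in D)])) => //.
- by case: inp.
- split; first by exists v; rewrite !inE eqxx.
  rewrite updateE s7; apply/esym/negbTE/existsP => -[u /and3P[]].
  by rewrite ltn0.
- move=> j s1 ltjn bs1 ag s1j [[z [s6z zv zmin]] s7E]; have [u uj] := idx_surj ltjn.
  have inp1 : reads_input s1 by apply: reads_input_agree inp (ag 0 isT).
  have s10' : s1 10 0 = idx v by rewrite (ag 10 isT).
  have s11 : s1 11 0 = idx u by rewrite s1j.
  have sD1 : holds_set 1 D s1 by move=> y; rewrite (ag 1 isT).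
  have s41 y : s1 4 (idx y) = cc y by rewrite (ag 4 isT).
  have test : (eval s1 (EAdd (adj_at 10 11) (eq_test (var 10) (var 11))) != 0)
      = (u \in cnbr v).
    have -> : eval s1 (EAdd (adj_at 10 11) (eq_test (var 10) (var 11))) =
        sedge v u + eval s1 (eq_test (var 10) (var 11)).
      by rewrite -(eval_adj inp1 s10' s11).
    rewrite addn_eq0 negb_and eq_testP /= s10' s11 idx_eq.
    by rewrite !inE [v == u]eq_sym orbC; case: (sedge v u).
  have flagN : u \notin cnbr v \/ u \notin D ->
      [exists y in cnbr v, (idx y < j.+1) && (y \in D)] =
      [exists y in cnbr v, (idx y < j) && (y \in D)].
    move=> uN; apply: eq_existsb => y; rewrite (idx_ltS y uj).
    by case: eqVneq => [->|//]; case: uN => /negPf->; rewrite ?andbF.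
  apply: (wp_ifb b_gt0 bs1 test) => uv; last first.
    apply: wp_skip => //; rewrite !updateE /= flagN; last by left.
    split=> //; exists z; split=> // y yv; rewrite (idx_ltS y uj).
    by case: eqVneq => [yu|_] /=; [rewrite -yu yv in uv | apply: zmin].
  apply: wp_seq.
  pose flag s' := (s' 7 0 != 0) = [exists y in cnbr v, (idx y < j.+1) && (y \in D)].
  have flagP : wp (FWhen (at_ 1 11) (FPut 7 (EConst 0) (EConst 1))) s1 flag.
    have testD : (eval s1 (at_ 1 11) != 0) = (u \in D) by rewrite /= s11 sD1.
    apply: (wp_ifb b_gt0 bs1 testD) => uD; last first.
      by apply: wp_skip => //; rewrite /flag flagN //; right.
    apply: wp_put => //; rewrite /flag !updateE /=; apply/esym/existsP; exists u.
    by rewrite uv uD uj ltnS leqnn.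
  apply: wp_conseq flagP _ => s2 bs2 ag2 flag2.
  have s62 : s2 6 0 = idx z by rewrite (ag2 6 isT).
  have s42 y : s2 4 (idx y) = cc y by rewrite (ag2 4 isT).
  have s112 : s2 11 0 = idx u by rewrite (ag2 11 isT).
  have test2 : (eval s2 (ESub (at_ 4 6) (at_ 4 11)) != 0) = (cc u < cc z).
    by rewrite /= s62 s112 !s42 subn_eq0 -ltnNge.
  apply: (wp_ifb b_gt0 bs2 test2) => lt_uz.
    apply: wp_put => //=.
    rewrite !updateE /= s112; split; last exact: flag2.
    exists u; split=> // y yv; rewrite (idx_ltS y uj).
    by case: eqVneq => [->|_ /= yj] //; apply: leq_trans (ltnW lt_uz) (zmin _ _ _).
  apply: wp_skip => //; rewrite !updateE /=; split; last exact: flag2.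
  exists z; split=> // y yv; rewrite (idx_ltS y uj).
  by case: eqVneq => [-> _|_ /= yj]; [rewrite leqNgt | apply: zmin].
- move=> s1 _ _ [[z [s6z zv zmin]] s7E]; split.
    by exists z; split=> // u uv; apply: zmin => //; apply: idx_lt.
  by rewrite s7E; apply: eq_existsb => u; rewrite idx_lt.
Qed.

(** The shape that [dominating_cost] asks for, with scaled costs. In the program, [U] collects the
    vertices found undominated at their turn. *)
Definition greedy_set (D U : {set G}) (best : G -> G) : Prop :=
  D \subset H :|: best @: U /\
  {in U, forall v, forall u, u \in cnbr v -> u \notin H /\ cc (best v) <= cc u}.

Lemma dominate_spec s : reads_input s -> bounded b s -> holds_set 1 H s ->
  (forall u, s 4 (idx u) = cc u) ->
  wp dominate s (fun s' => exists D U best, [/\ holds_set 1 D s',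
    greedy_set D U best & forall v, exists2 u, u \in cnbr v & u \in D]).
Proof.
move=> inp bs sH s4.
apply: (wp_for b_gt0 (fun i s' => exists D U best, [/\ holds_set 1 D s', H \subset D,
    greedy_set D U best, forall v, v \in U -> idx v < i
    & forall v, idx v < i -> exists2 u, u \in cnbr v & u \in D])) => //.
- by case: inp.
- exists H, set0, id; split=> //; last by move=> v; rewrite inE.
  by split=> [|v]; [apply: subsetUl | rewrite inE].
- move=> i s1 ltin bs1 ag s1i [D [U [best [sD HD [sDU Ubest] Ui dom]]]].
  have [v vi] := idx_surj ltin.
  have inp1 : reads_input s1 by apply: reads_input_agree inp (ag 0 isT).
  apply: wp_seq; apply: wp_put => //=.
  apply: wp_seq; apply: wp_put => //=; first exact: bounded_update.
    by apply: ltn_trans one_lt.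
  set s2 := update _ _ _ _; apply: wp_seq.
  have s2v : s2 10 0 = idx v by rewrite /s2 !updateE /= s1i.
  apply: wp_conseq (scan_neighbours_spec (v := v) (D := D) _ _ s2v _ _ _ _) _.
  + by apply: reads_input_agree inp1 _ => j; rewrite /s2 !updateE.
  + by do !apply: bounded_update => //; apply: ltn_trans one_lt.
  + by move=> u; rewrite /s2 !updateE /= sD.
  + by move=> u; rewrite /s2 !updateE /= (ag 4 isT) s4.
  + by rewrite /s2 !updateE /= s1i.
  + by rewrite /s2 !updateE.
  move=> s3 bs3 ag3 [[z [s6z zv zmin]] s7E].
  have sD3 : holds_set 1 D s3 by move=> u; rewrite (ag3 1 isT) /s2 !updateE /= sD.
  apply: (wp_ifb (e := var 7) b_gt0 bs3 s7E) => [/existsP[u /andP[uv uD]]|nodom].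
    apply: wp_skip => //; exists D, U, best; split=> //.
    - by move=> y /Ui yi; apply: ltnW.
    - apply: (forall_idx_ltS vi) => [|y yi _]; [by exists u | exact: dom].
  apply: wp_put => //; rewrite [eval _ _]/= [eval _ _]/= s6z.
  (* The members of [U] have smaller index than [v], so redefining [best] at [v] disturbs no earlier
     choice. *)
  pose best' y := if y == v then z else best y.
  have best'E y : y \in U -> best' y = best y.
    by move=> /Ui yi; rewrite /best' -idx_eq vi ltn_eqF.
  exists (z |: D), (v |: U), best'; split.
  - move=> u; rewrite !updateE /= idx_eq !inE.
    by case: (eqVneq u z) => //= _; rewrite sD3.
  - by apply: subset_trans HD (subsetUr _ _).
  - split.
      apply/subsetP => u /setU1P[->|/(subsetP sDU)].
        rewrite inE; apply/orP; right; apply/imsetP; exists v; rewrite ?setU11 //.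
        by rewrite /best' eqxx.
      rewrite !inE => /orP[->//|/imsetP[y Uy ->]]; apply/orP; right.
      by apply/imsetP; exists y; rewrite ?best'E // inE Uy orbT.
    move=> y /setU1P[->|Uy] u uy; last by rewrite best'E //; apply: Ubest.
    (* A heavy closed neighbour would already dominate [v], because [H] stays inside [D]. *)
    rewrite {1}/best' eqxx zmin //; split=> //; apply: contraNN nodom => Hu.
    by apply/existsP; exists u; rewrite uy (subsetP HD).
  - by move=> y /setU1P[->|/Ui yi]; [rewrite vi | apply: ltnW].
  - apply: (forall_idx_ltS vi) => [|y yi _]; first by exists z; rewrite ?setU11.
    by have [u uy uD] := dom y yi; exists u; rewrite // inE uD orbT.
- move=> s1 _ _ [D [U [best [sD HD greedy Ui dom]]]]; exists D, U, best; split=> // v.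
  by apply: dom; apply: idx_lt.
Qed.

Definition holds_lab (lab : G -> G) (s : state) : Prop :=
  forall v, s 3 (idx v) = idx (lab v).

Lemma find_dominator_spec s v (D : {set G}) : reads_input s -> bounded b s ->
  s 10 0 = idx v -> holds_set 1 D s -> s 3 (idx v) = idx v ->
  wp find_dominator s (fun s' =>
    (exists u, s' 3 (idx v) = idx u /\
       ((exists2 y, y \in D & sedge v y) -> u \in D /\ sedge v u))
    /\ forall z, z != v -> s' 3 (idx z) = s 3 (idx z)).
Proof.
move=> inp bs s10 sD s3.
apply: (wp_for b_gt0 (fun j s' =>
    (exists u, s' 3 (idx v) = idx u /\
       ((exists y, [/\ idx y < j, y \in D & sedge v y]) -> u \in D /\ sedge v u))
    /\ forall z, z != v -> s' 3 (idx z) = s 3 (idx z))) => //.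
- by case: inp.
- by split=> //; exists v; split=> // -[y []].
- move=> j s1 ltjn bs1 ag s1j [[u [s3u udom]] rest]; have [y yj] := idx_surj ltjn.
  have inp1 : reads_input s1 by apply: reads_input_agree inp (ag 0 isT).
  have s10' : s1 10 0 = idx v by rewrite (ag 10 isT).
  have s11 : s1 11 0 = idx y by rewrite s1j.
  have test : (eval s1 (EMul (adj_at 10 11) (at_ 1 11)) != 0) = (y \in D) && sedge v y.
    have -> : eval s1 (EMul (adj_at 10 11) (at_ 1 11)) = sedge v y * s1 1 (idx y).
      by rewrite -(eval_adj inp1 s10' s11) -s11.
    rewrite muln_eq0 negb_or (ag 1 isT) sD andbC; by case: (sedge v y).
  apply: (wp_ifb b_gt0 bs1 test) => [/andP[yD evy]|no].
    apply: wp_put => //=; rewrite s10' s11; split.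
      by exists y; rewrite !updateE /= eqxx.
    by move=> z zv; rewrite !updateE /= idx_eq (negPf zv) rest.
  apply: wp_skip => //; split=> //; exists u; split=> // -[z [zj zD evz]].
  apply: udom; exists z; split=> //; move: zj; rewrite (idx_ltS z yj).
  by case: eqVneq => // zy; rewrite -zy zD evz in no.
- move=> s1 _ _ [[u [s3u udom]] rest]; split=> //; exists u; split=> // -[y yD evy].
  by apply: udom; exists y; rewrite idx_lt.
Qed.

Lemma init_labels_spec s (D : {set G}) : reads_input s -> bounded b s ->
  holds_set 1 D s -> (forall u, s 4 (idx u) = cc u) ->
  (forall v, exists2 u, u \in cnbr v & u \in D) ->
  wp init_labels s (fun s' => exists lab, [/\ holds_set 2 D s', holds_lab lab s',
    forall v, s' 4 (idx v) = if v \in D then 0 else cc v,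
    forall v, v \in D -> lab v = v
    & forall v, v \notin D -> lab v \in D /\ sedge v (lab v)]).
Proof.
move=> inp bs sD s4 dom.
pose done (s' : state) v := [/\ (s' 2 (idx v) != 0) = (v \in D),
  s' 4 (idx v) = if v \in D then 0 else cc v
  & exists u, [/\ s' 3 (idx v) = idx u, v \in D -> u = v
                & v \notin D -> u \in D /\ sedge v u]].
apply: (wp_for b_gt0 (fun i s' => (forall v, idx v < i -> done s' v) /\
    forall v, i <= idx v -> s' 4 (idx v) = cc v)) => //.
- by case: inp.
- by split=> // v _; rewrite updateE /= s4.
- move=> i s1 ltin bs1 ag s1i [doneI rest]; have [v vi] := idx_surj ltin.
  have inp1 : reads_input s1 by apply: reads_input_agree inp (ag 0 isT).
  have sD1 : holds_set 1 D s1 by move=> y; rewrite (ag 1 isT).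
  apply: wp_seq; apply: wp_put => //=.
  apply: wp_seq; apply: (wp_put _ b_gt0); [exact: bounded_update | exact: bs1 |].
  have s1v : s1 10 0 = idx v by rewrite s1i.
  rewrite [eval _ _]/= [eval _ _]/= !updateE /= s1v; set s2 := update _ _ _ _.
  have bs2 : bounded b s2 by do !apply: bounded_update.
  have s2i : s2 10 0 = idx v by rewrite /s2 !updateE /= s1i.
  have sD2 : holds_set 1 D s2 by move=> y; rewrite /s2 !updateE /= sD1.
  have testD : (eval s2 (at_ 1 10) != 0) = (v \in D) by rewrite /= s2i sD2.
  have s22 : s2 2 (idx v) = s1 1 (idx v) by rewrite /s2 !updateE /= eqxx.
  have s23 : s2 3 (idx v) = idx v by rewrite /s2 !updateE /= eqxx.
  have s24 y : s2 4 (idx y) = s1 4 (idx y) by rewrite /s2 !updateE.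
  have old y : idx y < i -> y != v -> [/\ s2 2 (idx y) = s1 2 (idx y),
      s2 3 (idx y) = s1 3 (idx y) & s2 4 (idx y) = s1 4 (idx y)].
    by move=> yi yv; rewrite /s2 !updateE /= idx_eq (negPf yv).
  apply: (wp_ifb b_gt0 bs2 testD) => vD.
    apply: wp_put => //=; first by rewrite expn_gt0.
    rewrite s2i; split.
      apply: (forall_idx_ltS vi) => [|y yi yv].
        split; rewrite !updateE /= ?eqxx ?vD ?s22 ?sD1 //.
        by exists v; rewrite s23.
      have [o2 o3 o4] := old y yi yv; have [d2 d4 [u d3]] := doneI y yi.
      split; rewrite !updateE /= ?idx_eq ?(negPf yv) ?o2 ?o4 //.
      by exists u; rewrite o3.
    move=> y iy; rewrite !updateE /= idx_eq s24 ifN ?rest ?(ltnW iy) //.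
    by rewrite -idx_eq vi gtn_eqF.
  have inp2 : reads_input s2 by apply: reads_input_agree inp1 _ => j; rewrite /s2 !updateE.
  apply: wp_conseq (find_dominator_spec inp2 bs2 s2i sD2 s23) _.
  move=> s3 bs3 ag3 [[u [s3u udom]] s3rest]; split.
    apply: (forall_idx_ltS vi) => [|y yi yv].
      split; rewrite !updateE /= ?(ag3 2 isT) ?(ag3 4 isT) ?s22 ?sD1 //.
        by rewrite s24 (negPf vD) rest // vi.
      exists u; split=> // [vD'|_]; first by rewrite vD' in vD.
      apply: udom; have [y yv yD] := dom v; exists y => //; move: yv.
      by rewrite !inE => /orP[/eqP yv|//]; rewrite -yv yD in vD.
    have [o2 o3 o4] := old y yi yv; have [d2 d4 [u' d3]] := doneI y yi.
    split; rewrite !updateE /= ?(ag3 2 isT) ?(ag3 4 isT) ?o2 ?o4 //.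
    by exists u'; rewrite s3rest // o3.
  by move=> y iy; rewrite !updateE /= (ag3 4 isT) s24 rest // ltnW.
- move=> s1 _ _ [doneN _].
  have /fin_all_exists[lab labP] : forall v, exists u, [/\ s1 3 (idx v) = idx u,
      v \in D -> u = v & v \notin D -> u \in D /\ sedge v u].
    by move=> v; have [] := doneN v (idx_lt v).
  exists lab; split=> v; try by have [] := doneN v (idx_lt v).
  + by have [] := labP v.
  + by have [_ ? _] := labP v.
  + by have [_ _ ?] := labP v.
Qed.

Lemma relabel_prog_spec s lab u v : reads_input s -> bounded b s ->
  holds_lab lab s -> s 8 0 = idx u -> s 9 0 = idx v ->
  wp relabel_prog s (holds_lab (relabel lab u v)).
Proof.
move=> inp bs sl s8 s9.
apply: (wp_for b_gt0 (fun j s' => forall z,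
    s' 3 (idx z) = idx (if idx z < j then relabel lab u v z else lab z))) => //.
- by case: inp.
- move=> j s1 ltjn bs1 ag s1j Is1; have [y yj] := idx_surj ltjn.
  have s14 : s1 14 0 = idx y by rewrite s1j.
  have test : (eval s1 (eq_test (at_ 3 14) (var 8)) != 0) = (lab y == u).
    by rewrite eq_testP /= s14 Is1 (ag 8 isT) s8 yj ltnn idx_eq.
  apply: (wp_ifb b_gt0 bs1 test) => [/eqP yu|yu].
    apply: wp_put => //; first exact: bs1.
    move=> z; rewrite !updateE /= s14 idx_eq (idx_ltS z yj).
    have [->|zy] := eqVneq z y; last by rewrite Is1.
    by rewrite (ag 9 isT) s9 /relabel yu eqxx.
  apply: wp_skip => // z; rewrite !updateE /= Is1 (idx_ltS z yj).
  have [->|//] := eqVneq z y.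
  by rewrite yj ltnn /relabel (negPf yu).
- by move=> s1 _ _ Is1 z; rewrite Is1 idx_lt.
Qed.

(** One pass over the pairs is enough: relabelling never separates equal labels, so a settled pair
    stays settled. [Inv] is abstract because the price invariant differs between the calls. *)
Lemma merge_spec s (X K : {set G}) lab (Inv : {set G} -> (G -> G) -> Prop) :
  (forall K lab u v, Inv K lab -> u \in X -> v \in X -> sedge u v ->
     lab u != lab v -> Inv (u |: (v |: K)) (relabel lab (lab u) (lab v))) ->
  Inv K lab -> reads_input s -> bounded b s ->
  holds_set 2 X s -> holds_set 1 K s -> holds_lab lab s ->
  wp merge s (fun s' => exists K' lab',
    [/\ Inv K' lab', holds_set 1 K' s', holds_lab lab' s' & label_closed X lab']).
Proof.
move=> InvS Inv0 inp bs sX sK sl.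
pose compat (lab : G -> G) u v := u \in X -> v \in X -> sedge u v -> lab u = lab v.
apply: (wp_for b_gt0 (fun i s' => exists K' lab', [/\ Inv K' lab', holds_set 1 K' s',
   holds_lab lab' s' & forall u, idx u < i -> forall v, compat lab' u v])) => //.
- by case: inp.
- by exists K, lab.
- move=> i s1 ltin bs1 ag s1i [K1 [lab1 [Inv1 sK1 sl1 clos1]]].
  have [u ui] := idx_surj ltin.
  have inp1 : reads_input s1 by apply: reads_input_agree inp (ag 0 isT).
  apply: (wp_for b_gt0 (fun j s' => exists K' lab', [/\ Inv K' lab', holds_set 1 K' s',
     holds_lab lab' s', forall u, idx u < i -> forall v, compat lab' u v
     & forall v, idx v < j -> compat lab' u v])) => //.
  + by case: inp1.
  + by exists K1, lab1.
  + move=> j s2 ltjn bs2 ag2 s2j [K2 [lab2 [Inv2 sK2 sl2 clos2 closu]]].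
    have [v vj] := idx_surj ltjn.
    have inp2 : reads_input s2 by apply: reads_input_agree inp1 (ag2 0 isT).
    have s12 : s2 12 0 = idx u by rewrite (ag2 12 isT) s1i.
    have s13 : s2 13 0 = idx v by rewrite s2j.
    have sX2 : holds_set 2 X s2 by move=> y; rewrite (ag2 2 isT) (ag 2 isT).
    set e := EMul _ _.
    have test : (eval s2 e != 0) = [&& sedge u v, u \in X & v \in X].
      have -> : eval s2 e = sedge u v * (s2 2 (idx u) * s2 2 (idx v)).
        by rewrite -(eval_adj inp2 s12 s13) -s12 -s13.
      by rewrite !muln_eq0 !negb_or !sX2; case: (sedge u v).
    apply: (wp_ifb b_gt0 bs2 test) => [/and3P[euv Xu Xv]|no]; last first.
      apply: wp_skip => //; exists K2, lab2; split=> //.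
      apply: (forall_idx_ltS vj) => [Xu Xv euv|y yj _]; last exact: closu.
      by rewrite Xu Xv euv in no.
    apply: wp_seq; apply: wp_put => //=.
    apply: wp_seq; apply: (wp_put _ b_gt0); [exact: bounded_update | exact: bs2 |].
    rewrite [eval _ _]/= [eval _ _]/= !updateE /= s12 s13 !sl2; set s3 := update _ _ _ _.
    have bs3 : bounded b s3 by do !apply: bounded_update => //.
    have test3 : (eval s3 (eq_test (var 8) (var 9)) != 0) = (lab2 u == lab2 v).
      by rewrite eq_testP /= /s3 !updateE /= idx_eq.
    apply: (wp_ifb b_gt0 bs3 test3) => [/eqP luv|neuv].
      apply: wp_skip => //; exists K2, lab2; split=> //.
      by apply: (forall_idx_ltS vj) => [//|y yj _]; apply: closu.
    apply: wp_seq; apply: wp_put => //=.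
    apply: wp_seq; apply: wp_put => //=; first exact: bounded_update.
    set s4 := update _ _ _ _.
    have bs4 : bounded b s4 by do !apply: bounded_update => //.
    apply: wp_conseq (relabel_prog_spec (lab := lab2) (u := lab2 u) (v := lab2 v) _ bs4 _ _ _) _.
    * by apply: reads_input_agree inp2 _ => k; rewrite /s4 /s3 !updateE.
    * by move=> y; rewrite /s4 /s3 !updateE /= sl2.
    * by rewrite /s4 /s3 !updateE.
    * by rewrite /s4 /s3 !updateE.
    move=> s5 bs5 ag5 sl5.
    exists (u |: (v |: K2)), (relabel lab2 (lab2 u) (lab2 v)); split.
    * exact: InvS.
    * move=> y; rewrite !updateE /= (ag5 1 isT) /s4 /s3 !updateE /= s12 s13 !idx_eq !inE.
      case: (eqVneq y v) => [|_] /=; first by rewrite orbT.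
      by case: (eqVneq y u) => [|_] //=; rewrite sK2.
    * by move=> y; rewrite !updateE /= sl5.
    * by move=> y yi z Xy Xz eyz; apply: relabel_eq; apply: clos2.
    * apply: (forall_idx_ltS vj) => [_ _ _|y yj _ Xu' Xy euy].
        by rewrite /relabel eqxx eq_sym (negPf neuv).
      by apply: relabel_eq; apply: closu.
  + move=> s2 bs2 ag2 [K2 [lab2 [Inv2 sK2 sl2 clos2 closu]]].
    exists K2, lab2; split=> //.
    apply: (forall_idx_ltS ui) => [v|y yi _]; last exact: clos2.
    by apply: closu; apply: idx_lt.
- move=> s1 _ _ [K1 [lab1 [Inv1 sK1 sl1 clos1]]]; exists K1, lab1; split=> //.
  by move=> u v Xu Xv euv; apply: (clos1 u (idx_lt u) v).
Qed.

Section Degrees.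
Variables (X : {set G}) (lab : G -> G).

Lemma touch_test_spec s w a : reads_input s -> bounded b s ->
  holds_set 2 X s -> holds_lab lab s -> s 11 0 = idx w -> s 12 0 = idx a ->
  s 16 0 = 0 ->
  wp touch_test s (fun s' => s' 16 0 = touches X lab w a).
Proof.
move=> inp bs sX sl s11 s12 s16.
pose found j := [exists u, [&& idx u < j, u \in X, lab u == a & sedge u w]].
apply: (wp_for b_gt0 (fun j s' => s' 16 0 = found j)) => //.
- by case: inp.
- rewrite updateE /= s16; apply/esym/eqP; rewrite eqb0.
  by apply/existsP => -[u /and4P[]].
- move=> j s1 ltjn bs1 ag s1j Is1; have [u uj] := idx_surj ltjn.
  have inp1 : reads_input s1 by apply: reads_input_agree inp (ag 0 isT).
  have s11' : s1 11 0 = idx w by rewrite (ag 11 isT).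
  have s13 : s1 13 0 = idx u by rewrite s1j.
  set e := EMul _ _.
  have test : (eval s1 e != 0) = [&& u \in X, lab u == a & sedge u w].
    have -> : eval s1 e = sedge u w *
        (s1 2 (idx u) * eval s1 (eq_test (at_ 3 13) (var 12))).
      by rewrite -(eval_adj inp1 s13 s11') -s13.
    rewrite !muln_eq0 !negb_or eq_testP /= s13 (ag 2 isT) (ag 3 isT) (ag 12 isT).
    by rewrite sX sl s12 idx_eq; case: (sedge u w); rewrite ?andbF ?andbT.
  apply: (wp_ifb b_gt0 bs1 test) => [uP|uN].
    apply: wp_put => //; rewrite !updateE /=; apply/esym/eqP; rewrite eqb1.
    by apply/existsP; exists u; rewrite uj ltnS leqnn.
  apply: wp_skip => //; rewrite !updateE /= Is1; congr (nat_of_bool _).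
  apply: eq_existsb => y; rewrite (idx_ltS y uj).
  by case: (eqVneq y u) => [->|//]; rewrite (negPf uN) andbF.
- move=> s1 _ _ ->; congr (nat_of_bool _); apply: eq_existsb => u.
  by rewrite idx_lt.
Qed.

Lemma degree_of_spec s w : reads_input s -> bounded b s ->
  holds_set 2 X s -> holds_lab lab s -> s 11 0 = idx w -> s 15 (idx w) = 0 ->
  wp degree_of s (fun s' => s' 15 (idx w) = #|[set a | touches X lab w a]| /\
    forall z, z != w -> s' 15 (idx z) = s 15 (idx z)).
Proof.
move=> inp bs sX sl s11 s15.
pose cnt j := #|[set a | (idx a < j) && touches X lab w a]|.
apply: (wp_for b_gt0 (fun j s' => s' 15 (idx w) = cnt j /\
    forall z, z != w -> s' 15 (idx z) = s 15 (idx z))) => //.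
- by case: inp.
- split=> //; rewrite updateE /= s15; apply/esym/eqP; rewrite cards_eq0.
  by apply/eqP/setP => a; rewrite !inE.
- move=> j s1 ltjn bs1 ag s1j [s15j rest]; have [a aj] := idx_surj ltjn.
  have inp1 : reads_input s1 by apply: reads_input_agree inp (ag 0 isT).
  apply: wp_seq; apply: wp_put => //=; first by rewrite expn_gt0.
  set s2 := update _ _ _ _; apply: wp_seq.
  have bs2 : bounded b s2 by apply: bounded_update; rewrite ?expn_gt0.
  apply: wp_conseq (touch_test_spec (w := w) (a := a) _ bs2 _ _ _ _ _) _.
  + by apply: reads_input_agree inp1 _ => i; rewrite /s2 updateE.
  + by move=> v; rewrite /s2 updateE /= (ag 2 isT) sX.
  + by move=> v; rewrite /s2 updateE /= (ag 3 isT) sl.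
  + by rewrite /s2 updateE /= (ag 11 isT).
  + by rewrite /s2 updateE /= s1j.
  + by rewrite /s2 updateE.
  move=> s3 bs3 ag3 s316.
  have s311 : s3 11 0 = idx w by rewrite (ag3 11 isT) /s2 updateE /= (ag 11 isT).
  have s315 v : s3 15 (idx v) = s1 15 (idx v) by rewrite (ag3 15 isT) /s2 updateE.
  have cntS : cnt j + touches X lab w a = cnt j.+1.
    rewrite /cnt (cardsD1 a [set b | (idx b < j.+1) && _]) inE aj ltnSn addnC /=.
    congr (_ + _); apply: eq_card => y; rewrite !inE (idx_ltS y aj).
    by case: eqVneq => [->|] //=; rewrite aj ltnn.
  have sum : eval s3 (EAdd (at_ 15 11) (var 16)) = cnt j.+1.
    by rewrite /= s311 s315 s316 s15j cntS.
  apply: wp_put => //; rewrite sum.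
    by apply: leq_ltn_trans (max_card _) n_lt.
  split; first by rewrite !updateE /= s311 eqxx.
  by move=> z zw; rewrite !updateE /= s311 idx_eq (negPf zw) s315 rest.
- move=> s1 _ _ [s15n rest]; split=> //; rewrite s15n; apply: eq_card => a.
  by rewrite !inE idx_lt.
Qed.

Lemma degrees_spec s : reads_input s -> bounded b s ->
  holds_set 2 X s -> holds_lab lab s ->
  wp degrees s (fun s' => forall w, s' 15 (idx w) = ldeg X lab w).
Proof.
move=> inp bs sX sl.
apply: (wp_for b_gt0 (fun i s' => forall w, idx w < i -> s' 15 (idx w) = ldeg X lab w)) => //.
- by case: inp.
- move=> i s1 ltin bs1 ag s1i Is1; have [w wi] := idx_surj ltin.
  have inp1 : reads_input s1 by apply: reads_input_agree inp (ag 0 isT).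
  have s1w : s1 11 0 = idx w by rewrite s1i.
  apply: wp_seq; apply: wp_put => //=; first by rewrite expn_gt0.
  rewrite s1w; set s2 := update _ _ _ _.
  have bs2 : bounded b s2 by apply: bounded_update; rewrite ?expn_gt0.
  have sX2 : holds_set 2 X s2 by move=> v; rewrite /s2 updateE /= (ag 2 isT) sX.
  have s215 v : v != w -> s2 15 (idx v) = s1 15 (idx v).
    by move=> vw; rewrite /s2 updateE /= idx_eq (negPf vw).
  have testX : (eval s2 (at_ 2 11) != 0) = (w \in X).
    by rewrite /= /s2 !updateE /= s1w -sX2.
  apply: (wp_ifb b_gt0 bs2 testX) => [Xw|Xw].
    apply: wp_skip => //; apply: (forall_idx_ltS wi) => [|v vi vw].
      by rewrite updateE /= /s2 updateE /= eqxx /ldeg Xw.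
    by rewrite updateE /= s215 // Is1.
  apply: wp_conseq (degree_of_spec (w := w) _ bs2 sX2 _ _ _) _.
  + by apply: reads_input_agree inp1 _ => j; rewrite /s2 updateE.
  + by move=> v; rewrite /s2 updateE /= (ag 3 isT) sl.
  + by rewrite /s2 updateE /= s1w.
  + by rewrite /s2 updateE /= eqxx.
  move=> s3 bs3 ag3 [s3w s3rest]; apply: (forall_idx_ltS wi) => [|v vi vw].
    by rewrite updateE /= s3w /ldeg (negPf Xw).
  by rewrite updateE /= s3rest // s215 // Is1.
- by move=> s1 _ _ Is1 w; apply: Is1; apply: idx_lt.
Qed.

Variable rn : G -> nat.
Hypothesis ldeg_pos : forall w, w \notin X -> 0 < ldeg X lab w.

Lemma find_best_spec s : reads_input s -> bounded b s -> holds_set 2 X s ->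
  (forall v, s 4 (idx v) = rn v) -> (forall v, s 15 (idx v) = ldeg X lab v) ->
  wp find_best s (fun s' =>
    (exists w, [/\ s' 17 0 = idx w, w \notin X & forall v, v \notin X ->
       rn w * ldeg X lab v <= rn v * ldeg X lab w])
    \/ s' 17 0 = n /\ X = [set: G]).
Proof.
move=> inp bs sX s4 s15; have sn : s 0 0 = n by case: inp.
apply: wp_seq; apply: (wp_put _ b_gt0) => //; first exact: bs.
set s0 := update _ _ _ _.
have s017 : s0 17 0 = n by rewrite /s0 updateE /= sn.
have inp0 : reads_input s0 by apply: reads_input_agree inp _.
have bs0 : bounded b s0 by apply: bounded_update => //; apply: bs.
apply: (wp_for b_gt0 (fun j s' =>
    (exists w, [/\ s' 17 0 = idx w, w \notin X & forall v, idx v < j -> v \notin X ->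
       rn w * ldeg X lab v <= rn v * ldeg X lab w])
    \/ s' 17 0 = n /\ forall v, idx v < j -> v \in X)) => //.
- by right.
- move=> j s1 ltjn bs1 ag s1j Is1; have [u uj] := idx_surj ltjn.
  have s1u : s1 11 0 = idx u by rewrite s1j.
  have s14 v : s1 4 (idx v) = rn v by rewrite (ag 4 isT) -s4.
  have s115 v : s1 15 (idx v) = ldeg X lab v by rewrite (ag 15 isT) -s15.
  have s10 : s1 0 0 = n by rewrite (ag 0 isT) -sn.
  have testX : (eval s1 (at_ 2 11) != 0) = (u \in X).
    by rewrite /= s1u (ag 2 isT) -sX.
  apply: (wp_ifb b_gt0 bs1 testX) => Xu.
    apply: wp_skip => //; case: Is1 => [[w [s1w Xw wmin]]|[s1n allX]]; [left|right].
      exists w; split=> //; apply: (forall_idx_ltS uj) => [|v vj _]; last exact: wmin.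
      by rewrite Xu.
    by split=> //; apply: (forall_idx_ltS uj) => // v vj _; apply: allX.
  case: Is1 => [[w [s1w Xw wmin]]|[s1n allX]]; last first.
    apply: (wp_ifb (B := true)) => //.
      have -> : forall e1 e2, eval s1 (EAdd e1 e2) = eval s1 e1 + eval s1 e2 by [].
      by rewrite addn_eq0 negb_and eq_testP /= s1n s10 eqxx.
    move=> _; apply: wp_put => //=; left; exists u; rewrite !updateE /= s1u; split=> //.
    apply: (forall_idx_ltS uj) => // v vj _ Xv.
    by rewrite (allX v vj) in Xv.
  set e := EAdd _ _.
  have test : (eval s1 e != 0) = (rn u * ldeg X lab w < rn w * ldeg X lab u).
    have -> : eval s1 e = eval s1 (eq_test (var 17) (var 0)) +
        (rn w * ldeg X lab u - rn u * ldeg X lab w).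
      by rewrite -!s14 -!s115 -s1w -s1u.
    rewrite addn_eq0 negb_and eq_testP /= s1w s10 (ltn_eqF (idx_lt w)) /=.
    by rewrite subn_eq0 -ltnNge.
  apply: (wp_ifb b_gt0 bs1 test) => lt_uw; last first.
    apply: wp_skip => //; left; exists w; split=> //.
    apply: (forall_idx_ltS uj) => [_|v vj _]; last exact: wmin.
    by rewrite leqNgt.
  apply: wp_put => //=; left; exists u; rewrite !updateE /= s1u; split=> //.
  apply: (forall_idx_ltS uj) => // v vj _ Xv.
  have := wmin v vj Xv; have := ldeg_pos Xw => w0 vw.
  (* Transitivity of the cross-multiplied comparison, after multiplying by the positive degree of
     the old candidate [w]. *)
  rewrite -(leq_pmul2r w0) -mulnA [ldeg X lab v * _]mulnC mulnA.
  apply: leq_trans (_ : rn w * ldeg X lab u * ldeg X lab v <= _).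
    by rewrite leq_mul2r (ltnW lt_uw) orbT.
  by rewrite mulnAC [X in _ <= X]mulnAC leq_mul2r vw orbT.
- move=> s1 _ _ [[w [s1w Xw wmin]]|[s1n allX]]; [left|right].
    by exists w; split=> // v; apply: wmin; apply: idx_lt.
  by split=> //; apply/setP => v; rewrite inE allX // idx_lt.
Qed.

Lemma buy_spec s w : reads_input s -> bounded b s -> holds_set 2 X s ->
  (forall v, s 4 (idx v) = rn v) -> (forall v, s 15 (idx v) = ldeg X lab v) ->
  s 17 0 = idx w -> (forall v, ldeg X lab w * rn v < 2 ^ b) ->
  wp buy s (fun s' => holds_set 2 (w |: X) s' /\ forall v,
    s' 4 (idx v) = ldeg X lab w * rn v - rn w * ldeg X lab v).
Proof.
move=> inp bs sX s4 s15 s17 lt_b.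
apply: wp_seq; apply: wp_put => //=.
apply: wp_seq; apply: (wp_put _ b_gt0); [exact: bounded_update | exact: bs |].
rewrite [eval _ _]/= [eval _ _]/= !updateE /= s17 s4 s15; set s0 := update _ _ _ _.
have bs0 : bounded b s0.
  by do !apply: bounded_update => //; rewrite -?s4 -?s15.
have inp0 : reads_input s0.
  by apply: reads_input_agree inp _ => j; rewrite /s0 !updateE.
pose rn' v := ldeg X lab w * rn v - rn w * ldeg X lab v.
apply: wp_seq; apply: (wp_for b_gt0 (fun j s' => forall v,
    s' 4 (idx v) = if idx v < j then rn' v else rn v)) => //.
- by case: inp0.
- move=> j s1 ltjn bs1 ag s1j Is1; have [u uj] := idx_surj ltjn.
  have s1u : s1 11 0 = idx u by rewrite s1j.
  set e := ESub _ _; have eE : eval s1 e = rn' u.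
    have s14 : s1 4 (idx u) = rn u by rewrite Is1 uj ltnn.
    rewrite [eval _ _]/= s1u (ag 19 isT) (ag 18 isT) (ag 15 isT) s14.
    by rewrite /s0 !updateE /= s15.
  apply: wp_put => //; rewrite eE; first by apply: leq_ltn_trans (leq_subr _ _) _.
  move=> v; rewrite !updateE /= s1u idx_eq (idx_ltS v uj).
  by case: eqVneq => [->|_] //=; rewrite Is1.
move=> s1 bs1 ag Is1; apply: wp_put => //=; split.
  move=> v; rewrite !updateE /= (ag 17 isT) (ag 2 isT) /s0 !updateE /= s17 idx_eq !inE.
  by case: (eqVneq v w) => //= _; rewrite sX.
by move=> v; rewrite !updateE /= Is1 idx_lt.
Qed.

End Degrees.

(** * The connection phase and the whole program over the rationals *)

Section Correctness.
Variables (h : nat) (c x : G -> rat).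
Hypothesis no_clique : ~ clique_minor h (@sedge G) [set: G].
Hypothesis connG : connected_graph G.
Hypothesis c_ge0 : forall v, (0 <= c v)%R.
Hypothesis x_feas : lp_feasible x.
Hypothesis cE : forall v, ((cn v)%:R = c v * (cd v)%:R)%R.
Hypothesis xE : forall v, ((xn v)%:R = x v * (xd v)%:R)%R.
Hypothesis xd_gt0 : forall v, 0 < xd v.
Hypothesis Q_eq : Q = 2 * (2 ^ h.+1).+1.
Variable M : nat.
Hypothesis cc_le : forall v, cc v <= M.
Hypothesis M_lt : M * n.+1 ^ n < 2 ^ b.

Lemma ccE v : ((cc v)%:R = P%:R * c v :> rat)%R.
Proof.
have dvdP : cd v %| P by rewrite /P (bigD1 v) //= dvdn_mulr.
by rewrite natrM cE -mulrA -natrM mulnC divnK // mulrC.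
Qed.

Lemma P_gt0 : (0 < P%:R :> rat)%R.
Proof. by rewrite ltr0n prodn_gt0. Qed.

Lemma H_heavy : H = heavy h x.
Proof.
apply/setP => v; rewrite !inE Q_eq.
have d0 : (0 < (xd v)%:R :> rat)%R by rewrite ltr0n.
by rewrite -(ler_nat rat) natrM xE mulrA -{1}[((xd v)%:R)%R]mul1r ler_pM2r.
Qed.

Lemma greedy_cost D U best : greedy_set D U best ->
  (cost c D <= (4 * 2 ^ h.+1 + 2)%:R * lp_cost c x)%R.
Proof.
rewrite /greedy_set H_heavy => -[sD Ubest].
apply: (dominating_cost no_clique c_ge0 x_feas sD) => v Uv u vu.
have [hu le_cc] := Ubest v Uv u vu; split=> //.
by move: le_cc; rewrite -(ler_nat rat) !ccE ler_pM2l ?P_gt0.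
Qed.

Lemma ldeg_le_card (X : {set G}) lab w : ldeg X lab w <= n.
Proof. by rewrite /ldeg; case: ifP => // _; apply: max_card. Qed.

Lemma grow_spec s (D K : {set G}) lab : reads_input s -> bounded b s ->
  holds_set 2 D s -> holds_set 1 K s -> holds_lab lab s ->
  (forall v, s 4 (idx v) = if v \in D then 0 else cc v) ->
  label_inv D K lab -> label_closed D lab ->
  price_inv h c x D D K lab (fun v => if v \in D then 0 else P%:R * c v)%R P%:R ->
  wp grow s (fun s' => exists K' lab' r sc, [/\ holds_set 1 K' s',
    label_inv [set: G] K' lab', label_closed [set: G] lab'
    & price_inv h c x D [set: G] K' lab' r sc]).
Proof.
move=> inp bs sX0 sK0 sl0 s40 linv0 clos0 pinv0.
(* At least [i] vertices are bought after [i] rounds, and each round multiplies residual costs by at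
   most a degree, whence [M * n.+1 ^ i]. The scale [sc] lives only in the proof, not in memory. *)
pose good i (s' : state) (X K : {set G}) lab (rn : G -> nat) sc :=
  [/\ [/\ i <= #|X|, holds_set 2 X s', holds_set 1 K s' & holds_lab lab s'],
      forall v, s' 4 (idx v) = rn v, forall v, rn v <= M * n.+1 ^ i
    & [/\ label_inv X K lab, label_closed X lab
        & price_inv h c x D X K lab (fun v => (rn v)%:R)%R sc]].
apply: (wp_for b_gt0 (fun i s' => exists X K lab rn sc, good i s' X K lab rn sc)) => //.
- by case: inp.
- exists D, K, lab, (fun v => if v \in D then 0 else cc v), (P%:R)%R; split=> //.
    by move=> v; case: ifP => // _; rewrite expn0 muln1.
  split=> //; apply: price_inv_ext pinv0 => v; case: ifP => // _; exact: ccE.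
- move=> i s1 ltin bs1 ag s1i [X [K1 [lab1 [rn [sc [[iX sX sK sl] s4 rn_le [linv clos pinv]]]]]]].
  have inp1 : reads_input s1 by apply: reads_input_agree inp (ag 0 isT).
  apply: wp_seq; apply: wp_conseq (degrees_spec inp1 bs1 sX sl) _ => s2 bs2 ag2 s215.
  have inp2 : reads_input s2 by apply: reads_input_agree inp1 (ag2 0 isT).
  have sX2 : holds_set 2 X s2 by move=> v; rewrite (ag2 2 isT) sX.
  have s24 v : s2 4 (idx v) = rn v by rewrite (ag2 4 isT) s4.
  apply: wp_seq.
  apply: wp_conseq (find_best_spec (fun w => ldeg_gt0 linv (w := w)) inp2 bs2 sX2 s24 s215) _.
  move=> s3 bs3 ag3 best.
  have inp3 : reads_input s3 by apply: reads_input_agree inp2 (ag3 0 isT).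
  have sX3 : holds_set 2 X s3 by move=> v; rewrite (ag3 2 isT) sX2.
  have s34 v : s3 4 (idx v) = rn v by rewrite (ag3 4 isT) s24.
  have s315 v : s3 15 (idx v) = ldeg X lab1 v by rewrite (ag3 15 isT) s215.
  have sK3 : holds_set 1 K1 s3 by move=> v; rewrite (ag3 1 isT) (ag2 1 isT) sK.
  have sl3 : holds_lab lab1 s3 by move=> v; rewrite (ag3 3 isT) (ag2 3 isT) sl.
  have s30 : s3 0 0 = n by case: inp3.
  have powS : M * n.+1 ^ i.+1 = n.+1 * (M * n.+1 ^ i) by rewrite expnS mulnCA.
  apply: wp_seq.
  pose mid (s' : state) := exists (X' : {set G}) (rn' : G -> nat) sc',
    [/\ [/\ i < #|X'|, holds_set 2 X' s' & forall v, s' 4 (idx v) = rn' v], forall v, rn' v <= M * n.+1 ^ i.+1,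
      label_inv X' K1 lab1 & price_inv h c x D X' K1 lab1 (fun v => (rn' v)%:R)%R sc'].
  have midP : wp (FWhen (ESub (var 0) (var 17)) buy) s3 mid.
    case: best => [[w [s3w Xw wmin]]|[s3n XT]].
      apply: (wp_ifb (B := true)) => //.
        by rewrite /= s30 s3w subn_eq0 -ltnNge idx_lt.
      move=> _; have lt_b v : ldeg X lab1 w * rn v < 2 ^ b.
        apply: leq_ltn_trans M_lt; apply: leq_trans (_ : M * n.+1 ^ i.+1 <= _).
          by rewrite powS leq_mul // (leq_trans (ldeg_le_card _ _ _)).
        by rewrite leq_mul2l leq_pexp2l ?orbT.
      apply: wp_conseq (buy_spec inp3 bs3 sX3 s34 s315 s3w lt_b) _.
      move=> s4' _ _ [sX4 s44].
      exists (w |: X), (fun v => ldeg X lab1 w * rn v - rn w * ldeg X lab1 v).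
      exists ((ldeg X lab1 w)%:R * sc)%R; split.
      - by split=> //; rewrite cardsU1 Xw.
      - move=> v; apply: leq_trans (leq_subr _ _) _.
        by rewrite powS leq_mul // (leq_trans (ldeg_le_card _ _ _)).
      - by case: linv => sKX ? ? ?; split=> //; apply: subset_trans sKX (subsetUr _ _).
      have wmin' v : v \notin X -> ((rn w)%:R * (ldeg X lab1 v)%:R <=
          (rn v)%:R * (ldeg X lab1 w)%:R :> rat)%R.
        by move=> Xv; rewrite -!natrM ler_nat wmin.
      apply: price_inv_ext (price_step no_clique connG x_feas linv clos pinv Xw wmin') => v.
      (* The truncated subtraction of the program is exact: [w] has the least ratio, and degrees
         vanish on [X]. *)
      rewrite natrB ?natrM //; have [Xv|Xv] := boolP (v \in X).
        by rewrite [ldeg X lab1 v]/ldeg Xv muln0.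
      by rewrite [X in _ <= X]mulnC wmin.
    apply: (wp_ifb (B := false)) => //.
      by rewrite /= s30 s3n subnn.
    (* Nothing is left to buy, and [#|X| = n] still exceeds [i]. *)
    move=> _; apply: wp_skip => //; exists X, rn, sc; split=> //.
      by split=> //; rewrite XT cardsT.
    by move=> v; apply: leq_trans (rn_le v) _; rewrite powS leq_pmull.
  apply: wp_conseq midP _ => s4' bs4 ag4 [X' [rn' [sc' [[iX' sX' s44] rn'_le linv' pinv']]]].
  have inp4 : reads_input s4' by apply: reads_input_agree inp3 (ag4 0 isT).
  have sK4 : holds_set 1 K1 s4' by move=> v; rewrite (ag4 1 isT) sK3.
  have sl4 : holds_lab lab1 s4' by move=> v; rewrite (ag4 3 isT) sl3.
  pose Inv K lab := label_inv X' K lab /\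
    price_inv h c x D X' K lab (fun v => (rn' v)%:R)%R sc'.
  have InvS K2 lab2 u v : Inv K2 lab2 -> u \in X' -> v \in X' -> sedge u v ->
      lab2 u != lab2 v -> Inv (u |: (v |: K2)) (relabel lab2 (lab2 u) (lab2 v)).
    move=> [li pi] Xu Xv euv neuv; split; first exact: merge_label_inv.
    exact: merge_price_inv.
  apply: wp_conseq (merge_spec InvS (conj linv' pinv') inp4 bs4 sX' sK4 sl4) _.
  move=> s5 bs5 ag5 [K2 [lab2 [[linv2 pinv2] sK5 sl5 clos5]]].
  exists X', K2, lab2, rn', sc'; split=> //.
    split=> //.
    by move=> v; rewrite updateE /= (ag5 2 isT) sX'.
  by move=> v; rewrite updateE /= (ag5 4 isT) s44.
- move=> s1 _ _ [X [K1 [lab1 [rn [sc [[iX sX sK sl] s4 rn_le [linv clos pinv]]]]]]].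
  have XT : X = [set: G] by apply/eqP; rewrite eqEcard subsetT cardsT.
  rewrite XT in linv clos pinv.
  by exists K1, lab1, (fun v => (rn v)%:R)%R, sc.
Qed.

Lemma cds_program_spec s : reads_input s -> bounded b s ->
  wp (cds_program Q) s (fun s' => exists K, [/\ holds_set 1 K s', cds K
    & (cost c K <= (7 * 2 ^ h.+1 + 2)%:R * lp_cost c x)%R]).
Proof.
move=> inp bs.
apply: wp_seq; apply: wp_conseq (denominators_spec inp bs) _ => s1 bs1 ag1 s15.
have inp1 : reads_input s1 by apply: reads_input_agree inp (ag1 0 isT).
apply: wp_seq; apply: wp_conseq (scale_costs_spec inp1 bs1 s15) _ => s2 bs2 ag2 s24.
have inp2 : reads_input s2 by apply: reads_input_agree inp1 (ag2 0 isT).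
apply: wp_seq; apply: wp_conseq (take_heavy_spec inp2 bs2) _ => s3 bs3 ag3 sH.
have inp3 : reads_input s3 by apply: reads_input_agree inp2 (ag3 0 isT).
have s34 v : s3 4 (idx v) = cc v by rewrite (ag3 4 isT) s24.
apply: wp_seq; apply: wp_conseq (dominate_spec inp3 bs3 sH s34) _.
move=> s4 bs4 ag4 [D [U [best [sD /greedy_cost D_le dom]]]].
have inp4 : reads_input s4 by apply: reads_input_agree inp3 (ag4 0 isT).
have s44 v : s4 4 (idx v) = cc v by rewrite (ag4 4 isT) s34.
apply: wp_seq; apply: wp_conseq (init_labels_spec inp4 bs4 sD s44 dom) _.
move=> s5 bs5 ag5 [lab [sX sl s54 labD labN]].
have inp5 : reads_input s5 by apply: reads_input_agree inp4 (ag5 0 isT).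
have sD5 : holds_set 1 D s5 by move=> v; rewrite (ag5 1 isT) sD.
have linv := label_inv_init labD labN.
have pinv := price_inv_init h c_ge0 x_feas D lab P_gt0.
pose Inv K lab := label_inv D K lab /\ price_inv h c x D D K lab
   (fun v => if v \in D then 0 else P%:R * c v)%R P%:R.
have InvS K2 lab2 u v : Inv K2 lab2 -> u \in D -> v \in D -> sedge u v ->
    lab2 u != lab2 v -> Inv (u |: (v |: K2)) (relabel lab2 (lab2 u) (lab2 v)).
  move=> [li pi] Xu Xv euv neuv; split; first exact: merge_label_inv.
  exact: merge_price_inv.
apply: wp_seq; apply: wp_conseq (merge_spec InvS (conj linv pinv) inp5 bs5 sX sD5 sl) _.
move=> s6 bs6 ag6 [K [lab' [[linv6 pinv6] sK6 sl6 clos6]]].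
have inp6 : reads_input s6 by apply: reads_input_agree inp5 (ag6 0 isT).
have sX6 : holds_set 2 D s6 by move=> v; rewrite (ag6 2 isT) sX.
have s64 v : s6 4 (idx v) = if v \in D then 0 else cc v by rewrite (ag6 4 isT) s54.
apply: wp_conseq (grow_spec inp6 bs6 sX6 sK6 sl6 s64 linv6 clos6 pinv6) _.
move=> s7 bs7 ag7 [K' [lab7 [r [sc [sK7 linv7 clos7 pinv7]]]]]; exists K'.
by have [] := total_cost connG c_ge0 x_feas D_le linv7 clos7 pinv7.
Qed.

End Correctness.

End Program.

(** * The encoding of instances *)

Lemma nth_allpairs (S T U : Type) (f : S -> T -> U) x0 y0 z0 s t i j :
  i < size s -> j < size t ->
  nth z0 [seq f x y | x <- s, y <- t] (i * size t + j) = f (nth x0 s i) (nth y0 t j).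
Proof.
elim: s i => [|x s IH] [|i] //= lis ljt; rewrite nth_cat size_map.
  by rewrite ljt (nth_map y0).
by rewrite mulSn -addnA ltnNge leq_addr /= addKn IH.
Qed.

Lemma nth_cat_addl (T : Type) x0 (s t : seq T) k j :
  size s = k -> nth x0 (s ++ t) (k + j) = nth x0 t j.
Proof. by move=> <-; rewrite nth_cat ltnNge leq_addr /= addKn. Qed.

Lemma nth_map_idx (G : sgraph) (f : G -> nat) (s : seq nat) v :
  nth 0 ([seq f u | u <- enum G] ++ s) (idx v) = f v.
Proof.
rewrite nth_cat size_map -cardE idx_lt (nth_map v) ?nth_enum_rank //.
by rewrite -cardE idx_lt.
Qed.

Lemma leq_expn2r m n e : m <= n -> m ^ e <= n ^ e.
Proof. by case: e => // e le_mn; rewrite leq_exp2r. Qed.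

Section Encoding.
Variable i : instance.
Let n := #|i|.
Let cn (v : i) := `|numq (inst_c i v)|%N.
Let cd (v : i) := `|denq (inst_c i v)|%N.
Let xn (v : i) := `|numq (inst_x i v)|%N.
Let xd (v : i) := `|denq (inst_x i v)|%N.
Let w := encode i.
Let N := input_size w.

Lemma encode_reads_input : reads_input cn cd xn xd (init_state w).
Proof.
have szA : size [seq nat_of_bool (sedge u v) | u <- enum i, v <- enum i] = n * n.
  by rewrite size_allpairs -cardE.
have sz (f : i -> nat) : size [seq f v | v <- enum i] = n by rewrite size_map -cardE.
split=> [//|u v|v|v]; rewrite /init_state /= /w /encode ?add1n /= ?add0n.
- rewrite nth_cat szA.
  have -> : idx u * n + idx v < n * n by have := idx_lt u; have := idx_lt v; rewrite -/n; nia.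
  rewrite cardE (nth_allpairs _ u v) ?nth_enum_rank // -cardE; exact: idx_lt.
- have -> : n * (n + 1) + idx v = n * n + (n + idx v) by rewrite mulnDr muln1 addnA.
  by rewrite addn0 !(nth_cat_addl, nth_map_idx).
- have -> : n * (n + 2) + idx v = n * n + (n + (n + idx v)) by lia.
  have -> : n * (n + 3) + idx v = n * n + (n + (n + (n + idx v))) by lia.
  rewrite !(nth_cat_addl, nth_map_idx) //; split=> //.
  by rewrite -[X in nth _ X]cats0 nth_map_idx.
Qed.

Lemma input_size_cat s t : input_size (s ++ t) = input_size s + input_size t.
Proof. exact: big_cat. Qed.

Lemma bitlen_le_input k : k \in w -> bitlen k <= N.
Proof. by move=> wk; rewrite /N /input_size (big_rem k) //= leq_addr. Qed.

Lemma encode_lt k : nth 0 w k < 2 ^ N.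
Proof.
have [wk|wk] := ltnP k (size w); last by rewrite nth_default // expn_gt0.
apply: leq_trans (ltn_bitlen _) _; rewrite leq_exp2l //.
by apply: bitlen_le_input; apply: mem_nth.
Qed.

Lemma card_le_input : n <= N.
Proof.
apply: (@leq_trans (size w)).
  by rewrite /w /encode /= !size_cat size_map -cardE -/n; lia.
by rewrite -sum1_size; apply: leq_sum.
Qed.

(** The denominators are part of the input, and the length of a product is at most the sum of the
    lengths. *)
Lemma prod_den_le : \prod_v cd v <= 2 ^ N.
Proof.
apply: (@leq_trans (2 ^ \sum_v bitlen (cd v))).
  elim/big_ind2: _ => // [m1 m2 k1 k2 le1 le2|v _].
    by rewrite expnD leq_mul.
  exact/ltnW/ltn_bitlen.
rewrite leq_exp2l //.
have -> : \sum_v bitlen (cd v) =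
    input_size [seq `|denq (inst_c i v)|%N | v <- enum i].
  by rewrite /input_size big_map big_enum.
rewrite /N /w /encode -cat1s !input_size_cat; lia.
Qed.

Lemma den_gt0 (q : rat) : 0 < `|denq q|%N.
Proof. by rewrite absz_gt0 denq_neq0. Qed.

Lemma num_den (q : rat) : (0 <= q)%R -> (`|numq q|%N%:R = q * `|denq q|%N%:R)%R.
Proof.
move=> q0; rewrite !natr_absz ger0_norm ?numq_ge0 // ger0_norm ?denq_ge0 //.
exact: numqE.
Qed.

Lemma cds_program_exec h :
  ~ clique_minor h (@sedge i) [set: i] -> connected_graph i ->
  (forall v, (0 <= inst_c i v)%R) -> lp_feasible (inst_x i) ->
  let p := cds_program (2 * (2 ^ h.+1).+1) in
  exists t s, [/\ exec (compile p) (init_state w) t s,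
    t <= N.+1 ^ 2 * pcost p n, cds (output_set i s)
    & (cost (inst_c i) (output_set i s) <=
        (7 * 2 ^ h.+1 + 2)%:R * lp_cost (inst_c i) (inst_x i))%R].
Proof.
(* Scaled costs are at most [2 ^ (N + N)] and [n] rounds contribute at most [(2 ^ N) ^ N]; the
   exponent [N ^ 2 + 2 * N] is just below [N.+1 ^ 2]. *)
move=> noK connG c0 feas p; set b := N.+1 ^ 2.
have Nb : N < b by rewrite /b expnS expn1; nia.
have lt_b k : k <= 2 ^ N -> k < 2 ^ b.
  by move=> kN; apply: leq_ltn_trans kN _; rewrite ltn_exp2l.
have b0 : 0 < b by apply: leq_ltn_trans Nb.
have n_lt : n < 2 ^ b.
  apply: (@leq_trans (2 ^ n)); first exact: ltn_expl.
  by rewrite leq_exp2l // ltnW // (leq_ltn_trans card_le_input).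
have bs : bounded b (init_state w).
  move=> a k; rewrite /init_state; case: ifP => _; last by rewrite expn_gt0.
  exact/lt_b/ltnW/encode_lt.
have [_ _ x0] := feas.
have cd_gt0 v : 0 < cd v by apply: den_gt0.
have xd_gt0 v : 0 < xd v by apply: den_gt0.
have P_lt : \prod_v cd v < 2 ^ b by apply/lt_b/prod_den_le.
have cn_le v : cn v <= 2 ^ N.
  by have [_ _ /(_ v)[<- _] _] := encode_reads_input; apply/ltnW/encode_lt.
have cc_le v : cn v * (\prod_u cd u %/ cd v) <= 2 ^ (N + N).
  rewrite expnD leq_mul //; exact: leq_trans (leq_div _ _) prod_den_le.
have M_lt : 2 ^ (N + N) * n.+1 ^ n < 2 ^ b.
  apply: (@leq_ltn_trans (2 ^ (N + N) * (2 ^ N) ^ N)).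
    rewrite leq_mul2l; apply/orP; right; apply: (@leq_trans ((2 ^ N) ^ n)).
      apply: leq_expn2r; apply: (@leq_trans (2 ^ n)); first exact: ltn_expl.
      by rewrite leq_exp2l ?card_le_input.
    by rewrite leq_pexp2l ?expn_gt0 // card_le_input.
  by rewrite -expnM -expnD ltn_exp2l // /b expnS expn1; nia.
have cc_lt v : cn v * (\prod_u cd u %/ cd v) < 2 ^ b.
  apply: leq_ltn_trans (cc_le v) _; apply: leq_ltn_trans M_lt.
  by rewrite leq_pmulr // expn_gt0.
have cE v : ((cn v)%:R = inst_c i v * (cd v)%:R)%R by apply: num_den.
have xE v : ((xn v)%:R = inst_x i v * (xd v)%:R)%R by apply: num_den.
have [t [s [ex le_t _ [K [sK cdsK costK]]]]] :=
  cds_program_spec b0 n_lt cd_gt0 P_lt cc_lt noK connG c0 feas cE xE xd_gt0 erefl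
    cc_le M_lt encode_reads_input bs.
exists t, s; have -> : output_set i s = K by apply/setP => v; rewrite inE sK.
by split.
Qed.

End Encoding.

(** The infimum is thus taken over a nonempty set, and rounding this solution shows that some
    connected dominating set exists. *)
Lemma lp_feasible1 (R : numDomainType) (G : sgraph) :
  lp_feasible (fun _ : G => 1%R : R).
Proof.
split=> [v|S /and3P[_ N0 _]|//].
  by rewrite sumr_const ler1n card_gt0; apply/set0Pn; exists v; rewrite !inE eqxx.
by rewrite sumr_const ler1n card_gt0.
Qed.

Local Open Scope ring_scope.

Theorem theorem4 (R : realType) (F : sgraph -> Prop)
    (F_minor : minor_closed F) (F_proper : proper_family F) :
  exists C : R,
    (forall (G : sgraph) (c : G -> R),
       F G -> connected_graph G -> (forall v, 0 <= c v) ->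
       exists D : {set G}, min_cds c D /\ cost c D <= C * lp_opt c)
    /\
    (exists p : cmd,
       polytime_solves encode
         (fun i : instance =>
            [/\ F i, connected_graph i, forall v, 0 <= inst_c i v
              & lp_feasible (inst_x i)])
         (fun (i : instance) (s : state) =>
            let D := output_set i s in
            cds D /\
            ratr (cost (inst_c i) D)
              <= C * ratr (lp_cost (inst_c i) (inst_x i)))
         p).
Proof.
case: F_proper => H notFH; pose h := #|H|.
(* A clique minor on [#|H|] vertices would put the excluded graph [H] into [F]. *)
have no_clique G : F G -> ~ clique_minor h (@sedge G) [set: G].
  by move=> FG /clique_minor_minor; apply/contra_not/notFH; apply: F_minor.
pose A := (7 * 2 ^ h.+1 + 2)%N; exists A%:R; split=> [G c FG connG c0|].
  have [D0 [cdsD0 _]] := cds_rounding (no_clique _ FG) connG c0 (lp_feasible1 R G).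
  have D0P : `[< cds D0 >] by apply/asboolP.
  case: (@arg_minP _ R _ D0 (fun D => `[< cds D >]) (cost c) D0P) => D /asboolP cdsD Dmin.
  have {}Dmin D' : cds D' -> cost c D <= cost c D' by move=> ?; apply/Dmin/asboolP.
  exists D; split=> //.
  have A0 : 0 < A%:R :> R by rewrite ltr0n /A addn2.
  (* Attainment of the infimum is avoided: the minimum cost divided by [A] is a lower bound for the
     value of every feasible solution. *)
  rewrite -ler_pdivrMl //; apply: lb_le_inf.
    by exists (lp_cost c (fun=> 1)), (fun=> 1) => //; apply: lp_feasible1.
  move=> _ [x /= x_feas <-]; rewrite ler_pdivrMl //.
  have [D' [/Dmin le_DD' le_D']] := cds_rounding (no_clique _ FG) connG c0 x_feas.
  exact: le_trans le_DD' le_D'.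
set p := cds_program (2 * (2 ^ h.+1).+1); exists (compile p).
have [B [k p_le]] := pcost_poly p.
(* Two factors pay for cells of [N.+1 ^ 2] bits, the other [k] for the operation count, as
   [n <= N]. *)
exists (B *: ('X + 1) ^+ (k + 2)) => i [Fi conni c0 feas].
have [t [s [ex le_t cdsK costK]]] := cds_program_exec (no_clique _ Fi) conni c0 feas.
exists t, s; split=> //; last first.
  split=> //; rewrite -(ratr_nat R A) -rmorphM ler_rat; exact: costK.
apply: leq_trans le_t _; rewrite hornerZ horner_exp hornerD hornerX hornerC.
set N := input_size _.
have -> : (B * (N + 1) ^+ (k + 2))%R = (B * N.+1 ^ (k + 2))%N.
  by rewrite -[(N + 1)%R]/(N + 1)%N addn1 natrXE.
rewrite expnD mulnA mulnC leq_mul //.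
apply: leq_trans (p_le _) _; rewrite leq_mul2l leq_expn2r ?orbT // ltnS.
exact: card_le_input.
Qed.
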